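(* Let $d\ge 4$ be an integer. For every triple $\mathscr{L}=(L_1,L_2,L_3)$ of pairwise distinct elements of $\mathbb{P}S_1$, the map $\Gamma_{\mathscr{L}}\colon\Theta^3\setminus\Delta\to\Pi(\mathscr{L})\cap\overline{\Sigma}$ is a $\mathbf{D}$-cover of $\Pi(\mathscr{L})\cap\overline{\Sigma}$. In particular, the cardinality of the partition $(\Theta^3\setminus\Delta)/\Gamma_{\mathscr{L}}$ of $\Theta^3\setminus\Delta$ into the fibres of $\Gamma_{\mathscr{L}}$ does not depend on $\mathscr{L}$.
   Context: $S=\mathbb{C}[x,y]$, $S_i$ is the space of forms of degree $i$, and $\mathbb{P}S_i$ is its projectivization. The group $\mathrm{GL}_2(\mathbb{C})$ acts on $S_1$ (with basis $x,y$) and on $S_d=\mathrm{Sym}^d S_1$ by linear change of coordinates; this induces an action of $\mathrm{PGL}_2(\mathbb{C})$ on $\mathbb{P}S_1$ and $\mathbb{P}S_d$. $\mathcal{C}\subseteq\mathbb{P}S_d$ is the rational normal curve, the image of $\mathbb{P}S_1\to\mathbb{P}S_d$, $L\mapsto L^d$; $\Sigma$ is the union of all lines spanned by two different points of $\mathcal{C}$, and $\overline{\Sigma}$ is its Zariski closure. $\Pi(\mathscr{L})$ is the set of $F\in\mathbb{P}S_d$ that are multiples of $L_1L_2L_3$. $\Theta\subseteq\mathbb{C}$ is the set of $d$-th roots of unity, and $\Theta^3\setminus\Delta$ is the set of triples of pairwise distinct elements of $\Theta$. The map $\Gamma_{\mathscr{L}}$ is defined as follows: for $(\xi_i,\xi_j,\xi_k)\in\Theta^3\setminus\Delta$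 there is a unique $\varphi\in\mathrm{PGL}_2(\mathbb{C})$ with $\varphi([x-\xi_iy])=L_1$, $\varphi([x-\xi_jy])=L_2$, $\varphi([x-\xi_ky])=L_3$; set $\Gamma_{\mathscr{L}}(\xi_i,\xi_j,\xi_k)=\varphi\cdot[x^d-y^d]$. $\mathbf{D}$ is the dihedral group of order $2d$, the group of symmetries of $\Theta$ (the vertices of a regular $d$-gon; its elements are the maps $z\mapsto\zeta z$ and $z\mapsto\zeta\bar z$ with $\zeta\in\Theta$), acting componentwise on $\Theta^3\setminus\Delta$. For finite sets $X,Y$ and a group $G$, a map $f\colon X\to Y$ is a $G$-cover of $Y$ if $G$ acts faithfully on $X$ and the partition $X/f$ of $X$ into the (nonempty) fibres of $f$ equals the partition $X/G$ of $X$ into $G$-orbits. *)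

(* Defs.v *)
From HB Require Import structures.
From mathcomp Require Import all_boot all_order all_algebra.
From mathcomp Require Import all_fingroup all_solvable.
From mathcomp Require Import boolp classical_sets cardinality reals complex.
From mathcomp Require Import mpoly.

Set Implicit Arguments.
Unset Strict Implicit.
Unset Printing Implicit Defensive.

Import GRing.Theory Num.Theory.
Local Open Scope ring_scope.

(** * Projective spaces *)

(* P(V): the lines through the origin of V. *)
Definition proj (K : fieldType) (V : vectType K) : Type :=
  {U : {vspace V} | \dim U == 1%N}.

HB.instance Definition _ (K : fieldType) (V : vectType K) :=
  Choice.copy (proj V) {U : {vspace V} | \dim U == 1%N}.

Section Projective.
Variables (K : fieldType) (V : vectType K).

Definition line_of (p : proj V) : {vspace V} := sval p.

(* A nonzero vector spanning the line p. *)
Definition rep (p : proj V) : V := vpick (line_of p).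

Lemma proj_pt_subproof (v : V) : v != 0 -> \dim <[v]> == 1%N.
Proof. by rewrite dim_vline => ->. Qed.

Definition proj_pt (v : V) (v_neq0 : v != 0) : proj V :=
  exist _ <[v]>%VS (proj_pt_subproof v_neq0).

Lemma rep_neq0 (p : proj V) : rep p != 0.
Proof.
have := svalP p; rewrite /rep vpick0 /line_of.
by apply: contraTneq => ->; rewrite dimv0.
Qed.

Lemma line_of_rep (p : proj V) : line_of p = <[rep p]>%VS.
Proof.
apply/esym/eqP; rewrite eqEdim -memvE memv_pick.
by rewrite dim_vline rep_neq0 /line_of (eqP (svalP p)).
Qed.

Lemma proj_inj (p q : proj V) : line_of p = line_of q -> p = q.
Proof. by move=> eq_pq; apply: val_inj. Qed.

End Projective.

Coercion line_of : proj >-> space.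

(** * Binary forms *)

(* The space S_d of forms of degree d in S = C[x, y]. *)
Notation Sform C d := (dhomog 2 C d).

Section BinaryForms.
Variable C : numClosedFieldType.

Local Notation x := ('X_ord0 : {mpoly C[2]}).
Local Notation y := ('X_ord_max : {mpoly C[2]}).

(** ** The action of PGL_2 *)

(* Column j is the image of the j-th variable: A x_j = \sum_i A_ij x_i. *)
Definition lin_subst (A : 'M[C]_2) : 2.-tuple {mpoly C[2]} :=
  [tuple \sum_(i < 2) A i j *: 'X_i | j < 2].

Lemma lin_subst_homog (A : 'M[C]_2) (d : nat) (F : Sform C d) :
  (F : {mpoly C[2]}) \mPo lin_subst A \is d.-homog.
Proof.
rewrite comp_mpolyEX big_seq rpred_sum // => m m_in; apply/dhomogZ.
have /dhomogP/(_ m m_in) /= <- : (F : {mpoly C[2]}) \is d.-homog by case: (F).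
rewrite comp_mpolyX mdegE.
elim/big_rec2: _ => [|i e p _ pP]; first exact: dhomog1.
apply: dhomogM pP; have := @dhomogMn _ _ mdeg 1 (tnth (lin_subst A) i) (m i).
rewrite mul1n; apply; rewrite tnth_mktuple rpred_sum // => k _.
by apply/dhomogZ; rewrite dhomogX /= mdeg1.
Qed.

(* The action of A on S_d = Sym^d S_1 induced by its action on S_1. *)
Definition gl_act (d : nat) (A : 'M[C]_2) (F : Sform C d) : Sform C d :=
  DHomog (lin_subst_homog A F).

Lemma gl_act_is_linear (d : nat) (A : 'M[C]_2) : linear (@gl_act d A).
Proof.
by move=> c F G; apply: val_inj; rewrite /= comp_mpolyD comp_mpolyZ.
Qed.

HB.instance Definition _ (d : nat) (A : 'M[C]_2) :=
  GRing.isLinear.Build C (Sform C d) (Sform C d) _ (@gl_act d A)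
    (@gl_act_is_linear d A).

Lemma gl_actM (d : nat) (A B : 'M[C]_2) (F : Sform C d) :
  gl_act (A *m B) F = gl_act A (gl_act B F).
Proof.
apply: val_inj => /=; rewrite [in LHS]comp_mpolyEX.
rewrite [(F : {mpoly C[2]}) \mPo lin_subst B]comp_mpolyEX raddf_sum /=.
apply: eq_bigr => m _; rewrite comp_mpolyZ !comp_mpolyX rmorph_prod /=.
congr (_ *: _); apply: eq_bigr => j _; rewrite rmorphXn !tnth_mktuple /=.
congr (_ ^+ _); rewrite raddf_sum /=.
under eq_bigr => i _ do rewrite mxE scaler_suml.
rewrite exchange_big; apply: eq_bigr => k _.
rewrite comp_mpolyZ comp_mpolyXU -tnth_nth tnth_mktuple scaler_sumr.
by apply: eq_bigr => i _; rewrite scalerA mulrC.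
Qed.

Lemma gl_act1 (d : nat) (F : Sform C d) : gl_act 1%:M F = F.
Proof.
apply: val_inj => /=; rewrite -[RHS]comp_mpoly_id; congr comp_mpoly.
apply: eq_from_tnth => j; rewrite !tnth_mktuple (bigD1 j) //= big1 ?addr0.
  by rewrite mxE eqxx scale1r.
by move=> i /negPf ij; rewrite mxE ij scale0r.
Qed.

Lemma gl_actZ (d : nat) (c : C) (A : 'M[C]_2) (F : Sform C d) :
  gl_act (c *: A) F = c ^+ d *: gl_act A F.
Proof.
apply: val_inj => /=; rewrite !comp_mpolyEX scaler_sumr big_seq [RHS]big_seq.
apply: eq_bigr => m m_in; rewrite scalerA mulrC -scalerA; congr (_ *: _).
have /dhomogP/(_ m m_in) /= <- : (F : {mpoly C[2]}) \is d.-homog by case: (F).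
rewrite !comp_mpolyX mdegE -prodrXr -scaler_prod; apply: eq_bigr => j _.
rewrite !tnth_mktuple -exprZn scaler_sumr; congr (_ ^+ _).
by apply: eq_bigr => i _; rewrite mxE scalerA.
Qed.

(* PGL_2 = GL_2 / C^*, i.e. the points of P(M_2) that consist of invertible
   matrices (and zero). *)
Definition PGL2 : Type := {p : proj 'M[C]_2 | rep p \in unitmx}.

HB.instance Definition _ :=
  Choice.copy PGL2 {p : proj 'M[C]_2 | rep p \in unitmx}.

Lemma unitmx2_neq0 (A : 'M[C]_2) : A \in unitmx -> A != 0.
Proof. by apply: contraTneq => ->; rewrite unitmxE det0 unitr0. Qed.

Lemma pgl_of_subproof (A : 'M[C]_2) (A_unit : A \in unitmx) :
  rep (proj_pt (unitmx2_neq0 A_unit)) \in unitmx.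
Proof.
have : rep (proj_pt (unitmx2_neq0 A_unit)) \in <[A]>%VS by apply: memv_pick.
case/vlineP => c rep_c; have := rep_neq0 (proj_pt (unitmx2_neq0 A_unit)).
rewrite rep_c scaler_eq0 negb_or => /andP[c_neq0 _].
by rewrite unitmxZ // unitfE.
Qed.

Definition pgl_of (A : 'M[C]_2) (A_unit : A \in unitmx) : PGL2 :=
  exist _ (proj_pt (unitmx2_neq0 A_unit)) (pgl_of_subproof A_unit).

Definition pgl1 : PGL2 := pgl_of (unitmx1 C 2).

Lemma pgl_act_subproof (d : nat) (phi : PGL2) (p : proj (Sform C d)) :
  \dim (linfun (gl_act (rep (sval phi))) @: p)%VS == 1%N.
Proof.
rewrite line_of_rep limg_line lfunE /= dim_vline eqb1.
apply: contraNneq (rep_neq0 p) => /(congr1 (gl_act (invmx (rep (sval phi))))).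
have phi_unit : rep (sval phi) \in unitmx := svalP phi.
by rewrite -gl_actM mulVmx // gl_act1 raddf0 => ->.
Qed.

(* The image of p under any matrix that represents phi, see pgl_actE. *)
Definition pgl_act (d : nat) (phi : PGL2) (p : proj (Sform C d)) :
    proj (Sform C d) :=
  exist _ (linfun (gl_act (rep (sval phi))) @: p)%VS (pgl_act_subproof phi p).

Lemma pgl_actE (d : nat) (phi : PGL2) (p : proj (Sform C d))
    (A : 'M[C]_2) (F : Sform C d) :
  A != 0 -> A \in line_of (sval phi) -> F != 0 -> F \in line_of p ->
  line_of (pgl_act phi p) = <[gl_act A F]>%VS.
Proof.
move=> A_neq0 A_phi F_neq0 F_p.
have p_F : line_of p = <[F]>%VS.
  by apply/esym/eqP; rewrite eqEdim -memvE F_p dim_vline F_neq0 (eqP (svalP p)).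
rewrite {1}/line_of /pgl_act /= p_F limg_line lfunE /=.
move: A_phi; rewrite line_of_rep => /vlineP[c A_c].
have c_neq0 : c != 0 by apply: contraNneq A_neq0 => c0; rewrite A_c c0 scale0r.
rewrite A_c gl_actZ; apply: subv_anti; rewrite -!memvE memvZ ?memv_line //= andbT.
apply/vlineP; exists (c ^- d); rewrite scalerA mulVf ?scale1r //.
exact: expf_neq0.
Qed.

(** ** The secant variety of the rational normal curve *)

Lemma pow_form_homog (d : nat) (L : Sform C 1) :
  (L : {mpoly C[2]}) ^+ d \is d.-homog.
Proof. by have := dhomogMn d (dhomog_is_dhomog L); rewrite mul1n. Qed.

Definition pow_form (d : nat) (L : Sform C 1) : Sform C d :=
  DHomog (pow_form_homog d L).

Lemma pow_form_neq0 (d : nat) (p : proj (Sform C 1)) : pow_form d (rep p) != 0.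
Proof.
apply: contraNneq (rep_neq0 p) => /(congr1 val) /= /eqP.
by rewrite expf_eq0 => /andP[_ /eqP rep0]; apply/eqP/val_inj.
Qed.

(* The map P S_1 -> P S_d, [L] |-> [L^d]. *)
Definition veronese (d : nat) (p : proj (Sform C 1)) : proj (Sform C d) :=
  proj_pt (pow_form_neq0 d p).

Section Secants.
Local Open Scope classical_set_scope.

Definition rational_normal_curve (d : nat) : set (proj (Sform C d)) :=
  range (@veronese d).

(* The union of the lines spanned by two distinct points of the curve. *)
Definition secants (d : nat) : set (proj (Sform C d)) :=
  [set F | exists p q, [/\ rational_normal_curve p, rational_normal_curve q,
     p <> q & (F <= p + q)%VS]].

(* The homogeneous coordinates on P S_d are the coefficients of
   x^i y^(d - i), 0 <= i <= d. *)
Definition form_coef (d : nat) (F : Sform C d) (i : 'I_d.+1) : C :=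
  (F : {mpoly C[2]})@_(U_(ord0) *+ i + U_(ord_max) *+ (d - i))%MM.

Definition vanishes (d : nat) (g : {mpoly C[d.+1]}) (p : proj (Sform C d)) :=
  g.@[form_coef (rep p)] = 0.

Definition zariski_closed (d : nat) (Z : set (proj (Sform C d))) : Prop :=
  exists G : set {mpoly C[d.+1]},
    (forall g, G g -> g \is homog mdeg) /\
    Z = [set p | forall g, G g -> vanishes g p].

Definition zariski_closure (d : nat) (A : set (proj (Sform C d))) :
    set (proj (Sform C d)) :=
  \bigcap_(Z in [set Z | zariski_closed Z /\ A `<=` Z]) Z.

(* Pi(L): the classes of the forms of degree d divisible by L_1 L_2 L_3. *)
Definition multiples (d : nat) (L : 3.-tuple (proj (Sform C 1))) :
    set (proj (Sform C d)) :=
  [set F : proj (Sform C d) | exists G : {mpoly C[2]},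
     (rep F : {mpoly C[2]}) =
       G * \prod_(i < 3) (rep (tnth L i) : {mpoly C[2]})].

End Secants.

(** ** The map Gamma *)

Lemma root_form_subproof (xi : C) : x - xi *: y \is 1.-homog.
Proof. by rewrite rpredB ?rpredZ ?dhomogX /= ?mdeg1. Qed.

Definition root_form (xi : C) : Sform C 1 := DHomog (root_form_subproof xi).

Lemma root_form_neq0 (xi : C) : root_form xi != 0.
Proof.
apply/eqP => /(congr1 (fun F : Sform C 1 => (F : {mpoly C[2]})@_U_(ord0)%MM)).
rewrite /= mcoeffB mcoeffZ mcoeff0 !mcoeffX eqxx.
have /negPf-> : U_(ord_max)%MM != U_(ord0)%MM :> 'X_{1..2}.
  by apply/eqP => /mnmP/(_ ord0); rewrite !mnmE.
by move/eqP; rewrite mulr0 subr0 oner_eq0.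
Qed.

(* The point [x - xi y] of P S_1. *)
Definition root_pt (xi : C) : proj (Sform C 1) := proj_pt (root_form_neq0 xi).

(* The element of PGL_2 that maps p_i to q_i for i < 3; it exists and is unique
   if p and q consist of pairwise distinct points, see projectivity_unique. *)
Definition projectivity (p q : 3.-tuple (proj (Sform C 1))) : PGL2 :=
  xget pgl1 [set phi | forall i, pgl_act phi (tnth p i) = tnth q i]%classic.

(* Coordinates on S_1 in the basis (x, y). *)
Definition lin_coord (F : Sform C 1) : 'cV[C]_2 :=
  \col_i (F : {mpoly C[2]})@_U_(i).

Lemma lin_coordP (F : Sform C 1) :
  F = \sum_(i < 2) lin_coord F i 0 *: 'X_i :> {mpoly C[2]}.
Proof.
apply/mpolyP => m; rewrite raddf_sum /=.
have [/eqP/mdeg1P[j /eqP->]|m_neq1] := eqVneq (mdeg m) 1%N.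
  rewrite (bigD1 j) //= big1 ?addr0 => [|i /negPf i_j].
    by rewrite mcoeffZ mcoeffX eqxx mulr1 mxE.
  by rewrite mcoeffZ mcoeffX eq_mnm1 i_j mulr0.
rewrite (dhomog_nemf_coeff (dhomog_is_dhomog F) m_neq1) big1 // => i _.
rewrite mcoeffZ mcoeffX; have [Um|_] := eqVneq; last by rewrite mulr0.
by rewrite -Um mdeg1 eqxx in m_neq1.
Qed.

Lemma lin_coord_inj : injective lin_coord.
Proof.
by move=> F G FG; apply: val_inj; rewrite /= [LHS]lin_coordP FG -lin_coordP.
Qed.

Lemma lin_coord_is_linear : linear lin_coord.
Proof.
by move=> c F G; apply/colP => i; rewrite !mxE /= mcoeffD mcoeffZ.
Qed.

HB.instance Definition _ :=
  GRing.isLinear.Build C (Sform C 1) 'cV[C]_2 _ lin_coord lin_coord_is_linear.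

Lemma lin_coord_eq0 (F : Sform C 1) : (lin_coord F == 0) = (F == 0).
Proof. by rewrite -(inj_eq lin_coord_inj) raddf0. Qed.

Lemma lin_coord_act (A : 'M[C]_2) (F : Sform C 1) :
  lin_coord (gl_act A F) = A *m lin_coord F.
Proof.
apply/colP => k; rewrite !mxE /= {1}lin_coordP.
rewrite [(\sum_(_ < 2) _) \mPo _]raddf_sum raddf_sum /=.
apply: eq_bigr => j _; rewrite comp_mpolyZ comp_mpolyXU -tnth_nth tnth_mktuple.
rewrite mcoeffZ raddf_sum (bigD1 k) //= big1 ?addr0 => [|i /negPf i_k].
  by rewrite mcoeffZ mcoeffX eqxx mulr1 mulrC.
by rewrite mcoeffZ mcoeffX eq_mnm1 i_k mulr0.
Qed.

Lemma lin_coord_neq (p q : proj (Sform C 1)) (c : C) :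
  p <> q -> lin_coord (rep p) <> c *: lin_coord (rep q).
Proof.
move=> p_q; rewrite -linearZ => /lin_coord_inj rep_p; apply: p_q.
apply: proj_inj; apply/eqP; rewrite eqEdim {1}line_of_rep rep_p -memvE.
by rewrite memvZ ?memv_pick // /line_of (eqP (svalP p)) (eqP (svalP q)).
Qed.

Definition std_frame (i : 'I_3) : 'cV[C]_2 :=
  \col_k ((i == ord_max) || (i == k :> nat))%:R.

Lemma frame_ex (p : 3.-tuple (proj (Sform C 1))) : uniq p ->
  exists2 A : 'M[C]_2, A \in unitmx &
    forall i, exists2 c, c != 0 &
      A *m std_frame i = c *: lin_coord (rep (tnth p i)).
Proof.
move=> p_uniq.
have neq_p (i j : 'I_3) : i != j -> tnth p i <> tnth p j.
  by move=> i_j /(tuple_uniqP _ p_uniq) /eqP; rewrite (negPf i_j).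
pose u i := lin_coord (rep (tnth p i)).
have u_neq (i j : 'I_3) c : i != j -> u i <> c *: u j.
  by move=> i_j; apply/lin_coord_neq/neq_p.
pose i1 : 'I_3 := inord 1.
pose M : 'M[C]_2 := \matrix_(k, j) (if j == ord0 then u ord0 else u i1) k 0.
have ME (w : 'cV[C]_2) : M *m w = w ord0 0 *: u ord0 + w ord_max 0 *: u i1.
  apply/colP => k; rewrite !mxE big_ord_recl big_ord1 !mxE /=.
  by rewrite mulrC [X in _ + X]mulrC; congr (_ + w _ _ * _); apply: val_inj.
have i01 : ord0 != i1 by rewrite -val_eqE /= inordK.
have i02 : ord0 != ord_max :> 'I_3 by [].
have i12 : i1 != ord_max by rewrite -val_eqE /= inordK.
have M_unit : M \in unitmx.
  rewrite -unitmx_tr -row_free_unit -kermx_eq0.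
  apply: contraT => /rowV0Pn[v /sub_kermxP vM v_neq0].
  have : M *m v^T = 0 by rewrite -[M]trmxK -trmx_mul vM trmx0.
  rewrite ME !mxE; set a := v 0 ord0; set b := v 0 ord_max => ab.
  have [a0|a_neq0] := eqVneq a 0; last first.
    case: (u_neq ord0 i1 (- (a^-1 * b)) i01).
    apply: (scalerI a_neq0); apply/eqP; rewrite -subr_eq0 scaleNr scalerN opprK.
    by rewrite scalerA mulVKf // ab.
  have [b0|b_neq0] := eqVneq b 0.
    case/eqP: v_neq0; apply/rowP => k; rewrite [RHS]mxE.
    have [->|/negPf k0] := eqVneq k ord0; first exact: a0.
    rewrite -b0 /b; congr (v 0 _); apply: val_inj.
    by case: k k0 => [[|[|k]]].
  move/eqP: ab; rewrite a0 scale0r add0r scaler_eq0 (negPf b_neq0) /=.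
  by rewrite lin_coord_eq0 (negPf (rep_neq0 _)).
have [w Mw] : exists w : 'cV_2,
    w ord0 0 *: u ord0 + w ord_max 0 *: u i1 = u ord_max.
  by exists (invmx M *m u ord_max); rewrite -ME mulKVmx.
have w0_neq0 : w ord0 0 != 0.
  apply: contraPneq Mw => ->; rewrite scale0r add0r => /esym.
  by apply: u_neq; rewrite eq_sym.
have w1_neq0 : w ord_max 0 != 0.
  apply: contraPneq Mw => ->; rewrite scale0r addr0 => /esym.
  by apply: u_neq; rewrite eq_sym.
exists (M *m diag_mx w^T).
  rewrite unitmx_mul M_unit unitmxE det_diag unitfE.
  apply/prodf_neq0 => k _; rewrite mxE.
  have [->|/negPf k0] := eqVneq k ord0; first exact: w0_neq0.
  by have -> : k = ord_max by apply: val_inj; case: k k0 => [[|[|k]]].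
move=> i; rewrite -mulmxA ME mul_diag_mx !mxE -/(u i) /=.
have [->|i_neq2] := eqVneq i ord_max.
  by exists 1; rewrite ?oner_neq0 // !mulr1 Mw scale1r.
have [->|i_neq0] := eqVneq i ord0.
  by exists (w ord0 0); rewrite //= mulr1 mulr0 scale0r addr0.
have -> : i = i1
  by apply: val_inj; rewrite /= inordK //;
  case: i i_neq2 i_neq0 => [[|[|[|i]]]].
by exists (w ord_max 0); rewrite //= inordK // mulr1 mulr0 scale0r add0r.
Qed.

Lemma std_frame_scalar (A : 'M[C]_2) :
  (forall i, exists c, A *m std_frame i = c *: std_frame i) ->
  exists c, A = c%:M.
Proof.
move=> A_std; pose i1 : 'I_3 := inord 1.
have A_delta (k : 'I_2) (i : 'I_3) : i = k :> nat ->
    exists c, forall j, A j k = c * (j == k)%:R.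
  move=> i_k; have [c Ac] := A_std i; exists c => j.
  have e_k : std_frame i = delta_mx k 0.
    have i2 : (i == ord_max) = false.
      by apply: contraTF (ltn_ord k) => /eqP i2; rewrite -i_k i2.
    by apply/colP => l; rewrite !mxE eqxx andbT i2 i_k /= eq_sym.
  by have /colP/(_ j) := Ac; rewrite e_k -colE !mxE eqxx andbT.
have [a Aa] := A_delta ord0 ord0 erefl.
have [b Ab] := A_delta ord_max i1 (inordK (isT : (1 < 3)%N)).
have [c /colP Ac] := A_std ord_max.
exists c; apply/matrixP => j k; rewrite mxE.
have {}Ac l : A l ord0 + A l ord_max = c.
  by have := Ac l; rewrite !mxE big_ord_recl big_ord1 !mxE /= !mulr1 => <-;
    congr (_ + A l _); apply: val_inj.
have a_c : a = c by rewrite -(Ac ord0) Aa Ab /= mulr1 mulr0 addr0.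
have b_c : b = c by rewrite -(Ac ord_max) Aa Ab /= mulr1 mulr0 add0r.
have [->|k0] := eqVneq k ord0; first by rewrite Aa a_c mulr_natr.
have -> : k = ord_max by apply: val_inj; case: k k0 => [[|[|k]]].
by rewrite Ab b_c mulr_natr.
Qed.

Lemma pgl_actP (phi : PGL2) (p q : proj (Sform C 1)) :
  pgl_act phi p = q <->
  exists2 c, c != 0 & rep (sval phi) *m lin_coord (rep p) = c *: lin_coord (rep q).
Proof.
have phi_unit : rep (sval phi) \in unitmx := svalP phi.
have actE : line_of (pgl_act phi p) = <[gl_act (rep (sval phi)) (rep p)]>%VS.
  by apply: pgl_actE; rewrite ?rep_neq0 ?memv_pick.
split=> [pq|[c c_neq0]].
  have : gl_act (rep (sval phi)) (rep p) \in line_of q.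
    by rewrite -pq actE memv_line.
  rewrite line_of_rep => /vlineP[c act_c]; exists c; last first.
    by rewrite -lin_coord_act act_c linearZ.
  apply: contraTneq (rep_neq0 p) => c0; rewrite negbK -lin_coord_eq0.
  rewrite -[lin_coord _](mulKmx phi_unit) -lin_coord_act act_c c0 scale0r.
  by rewrite raddf0 mulmx0.
rewrite -lin_coord_act -linearZ => /lin_coord_inj act_c.
apply: proj_inj; apply/eqP; rewrite eqEdim {1}actE act_c -memvE.
by rewrite memvZ ?memv_pick // /line_of (eqP (svalP q)) (eqP (svalP (pgl_act phi p))).
Qed.

Lemma projectivity_unique (p q : 3.-tuple (proj (Sform C 1))) :
  uniq p -> uniq q ->
  exists! phi : PGL2, forall i, pgl_act phi (tnth p i) = tnth q i.
Proof.
move=> /frame_ex[A A_unit A_p] /frame_ex[B B_unit B_q].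
have M_unit : B *m invmx A \in unitmx by rewrite unitmx_mul B_unit unitmx_inv.
have pgl_uniq (phi psi : PGL2) :
    (forall i, pgl_act phi (tnth p i) = tnth q i) ->
    (forall i, pgl_act psi (tnth p i) = tnth q i) -> phi = psi.
  move=> phi_pq psi_pq.
  have phi_unit : rep (sval phi) \in unitmx := svalP phi.
  have psi_unit : rep (sval psi) \in unitmx := svalP psi.
  pose N := invmx A *m invmx (rep (sval psi)) *m rep (sval phi) *m A.
  have [i|k N_k] := @std_frame_scalar N.
    have [a a_neq0 Aa] := A_p i.
    have /pgl_actP[b b_neq0 phi_b] := phi_pq i.
    have /pgl_actP[c c_neq0 psi_c] := psi_pq i.
    exists (a * b * c^-1 * a^-1).
    have -> : std_frame i = a *: (invmx A *m lin_coord (rep (tnth p i))).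
      by rewrite scalemxAr -Aa mulKmx.
    rewrite /N -!scalemxAr -!mulmxA mulKVmx // phi_b !scalerA -!scalemxAr.
    have -> : lin_coord (rep (tnth q i)) =
        c^-1 *: (rep (sval psi) *m lin_coord (rep (tnth p i))).
      by rewrite psi_c scalerA mulVf // scale1r.
    by rewrite -!scalemxAr mulKmx // !scalerA mulfVK.
  have phi_k : rep (sval phi) = k *: rep (sval psi).
    have : rep (sval psi) *m (A *m N *m invmx A) = rep (sval phi).
      by rewrite /N -!mulmxA mulmxV // mulmx1 mulKVmx // mulKVmx.
    by move=> <-; rewrite N_k mul_mx_scalar -scalemxAl mulmxV // -scalemxAr mulmx1.
  have k_neq0 : k != 0.
    by apply: contraNneq (rep_neq0 (sval phi)) => k0; rewrite phi_k k0 scale0r.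
  apply/val_inj/proj_inj/eqP; rewrite eqEdim {1}line_of_rep /= phi_k -memvE.
  by rewrite memvZ ?memv_pick // /line_of (eqP (svalP (sval phi))) (eqP (svalP (sval psi))).
have M_q i : pgl_act (pgl_of M_unit) (tnth p i) = tnth q i.
  apply/pgl_actP.
  have : rep (sval (pgl_of M_unit)) \in <[B *m invmx A]>%VS by apply: memv_pick.
  case/vlineP => c rep_c; have := rep_neq0 (sval (pgl_of M_unit)).
  rewrite rep_c scaler_eq0 negb_or => /andP[c_neq0 _].
  have [a a_neq0 Aa] := A_p i; have [b b_neq0 Bb] := B_q i.
  exists (c * (a^-1 * b)); first by rewrite !mulf_neq0 ?invr_neq0.
  have -> : lin_coord (rep (tnth p i)) = a^-1 *: (A *m std_frame i).
    by rewrite Aa scalerA mulVf // scale1r.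
  rewrite -scalemxAl -scalemxAr -mulmxA mulKmx // Bb !scalerA.
  by rewrite mulrA.
by exists (pgl_of M_unit); split=> // psi; apply: pgl_uniq.
Qed.

Section RootsOfUnity.
Variables (d : nat) (d_ge4 : (4 <= d)%N).

Definition roots_seq : seq C :=
  sval (closed_field_poly_normal ('X^d - 1 : {poly C})).

(* The finite type of d-th roots of unity, see mem_roots_seq. *)
Definition Theta : finType := seq_sub roots_seq.

Lemma mem_roots_seq (z : C) : (z \in roots_seq) = d.-unity_root z.
Proof.
rewrite /roots_seq; case: closed_field_poly_normal => r /= def_p.
have lead1 : lead_coef ('X^d - 1 : {poly C}) = 1.
  by rewrite -polyC1 lead_coefXnsubC //; apply: leq_trans d_ge4.
by move: def_p; rewrite lead1 scale1r /root_of_unity => ->; rewrite root_prod_XsubC.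
Qed.

Lemma fermat_subproof : x ^+ d - y ^+ d \is d.-homog.
Proof.
have X_homog (i : 'I_2) : ('X_i : {mpoly C[2]}) ^+ d \is d.-homog.
  have := @dhomogMn _ _ mdeg 1 ('X_i : {mpoly C[2]}) d.
  by rewrite mul1n; apply; rewrite dhomogX /= mdeg1.
exact: rpredB.
Qed.

Definition fermat_form : Sform C d := DHomog fermat_subproof.

Lemma fermat_form_neq0 : fermat_form != 0.
Proof.
have d_gt0 : (0 < d)%N by apply: leq_trans d_ge4.
apply/eqP => /(congr1 (fun F : Sform C d =>
  (F : {mpoly C[2]}).@[fun i => (i == ord0)%:R])).
rewrite /= mevalB !rmorphXn /= !mevalXU meval0 eqxx expr1n expr0n.
by rewrite eqn0Ngt d_gt0 subr0 => /eqP; rewrite oner_eq0.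
Qed.

(* The point [x^d - y^d] of P S_d. *)
Definition fermat_pt : proj (Sform C d) := proj_pt fermat_form_neq0.

(* Meaningful only if the entries of t, and those of L, are pairwise distinct. *)
Definition Gamma (L : 3.-tuple (proj (Sform C 1))) (t : 3.-tuple Theta) :
    proj (Sform C d) :=
  pgl_act (projectivity [tuple of map (root_pt \o val) t] L) fermat_pt.

(* The symmetries z |-> zeta z and z |-> zeta z^* of Theta. *)
Definition dihedral_set : {set {perm Theta}} :=
  [set s : {perm Theta} | [exists zeta : Theta,
    [forall z, val (s z) == val zeta * val z] ||
    [forall z, val (s z) == val zeta * (val z)^*]]].

Lemma dihedral_group_set : group_set dihedral_set.
Proof.
have thetaP (z : Theta) : val z ^+ d = 1.
  by apply/unity_rootP; rewrite -mem_roots_seq; apply: valP.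
have in_theta (z : C) : z ^+ d = 1 -> exists t : Theta, val t = z.
  by move/unity_rootP; rewrite -mem_roots_seq => z_in; exists (SeqSub z_in).
have conjX (z : C) : (z ^+ d = 1 -> z^* ^+ d = 1)
  by move=> zd; rewrite -rmorphXn zd rmorph1.
apply/group_setP; split=> [|s t].
  have [u u1] := in_theta 1 (expr1n _ _); rewrite inE; apply/existsP; exists u.
  by apply/orP; left; apply/forallP => z; rewrite perm1 u1 mul1r.
rewrite !inE => /existsP[u us] /existsP[v vt].
case/orP: us => /forallP us; case/orP: vt => /forallP vt.
- have [|w w_eq] := in_theta (val v * val u); first by rewrite exprMn !thetaP mulr1.
  apply/existsP; exists w; apply/orP; left; apply/forallP => z.
  by rewrite permM (eqP (vt _)) (eqP (us _)) w_eq mulrA.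
- have [|w w_eq] := in_theta (val v * (val u)^*).
    by rewrite exprMn thetaP conjX ?thetaP ?mulr1.
  apply/existsP; exists w; apply/orP; right; apply/forallP => z.
  by rewrite permM (eqP (vt _)) (eqP (us _)) w_eq rmorphM mulrA.
- have [|w w_eq] := in_theta (val v * val u); first by rewrite exprMn !thetaP mulr1.
  apply/existsP; exists w; apply/orP; right; apply/forallP => z.
  by rewrite permM (eqP (vt _)) (eqP (us _)) w_eq mulrA.
- have [|w w_eq] := in_theta (val v * (val u)^*).
    by rewrite exprMn thetaP conjX ?thetaP ?mulr1.
  apply/existsP; exists w; apply/orP; left; apply/forallP => z.
  by rewrite permM (eqP (vt _)) (eqP (us _)) w_eq rmorphM /= conjCK mulrA.
Qed.

Canonical dihedral : {group {perm Theta}} := Group dihedral_group_set.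

Definition distinct_triples : {set 3.-tuple Theta} := 3.-dtuple([set: Theta]).

End RootsOfUnity.

End BinaryForms.

Arguments secants {C} d.
Arguments multiples {C} d L.
Arguments distinct_triples C d : clear implicits.
Arguments dihedral C {d} d_ge4.

(** * Covers *)

(* f : X -> Y is a G-cover of Y. Only the values of f and of the action on X
   matter; preim_partition f X is the partition X/f into nonempty fibres. *)
Definition is_cover (gT : finGroupType) (G : {group gT}) (xT : finType)
    (to : {action gT &-> xT}) (X : {set xT}) (yT : choiceType) (Y : set yT)
    (f : xT -> yT) : Prop :=
  [/\ finite_set Y,
      {in X, forall t, Y (f t)},
      [acts G, on X | to],
      [faithful G, on X | to] &
      preim_partition f X = orbit to G @: X].

(* Main.v *)
Require Import Defs.
From mathcomp Require Import all_boot all_order all_algebra.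
From mathcomp Require Import all_fingroup all_solvable all_field.
From mathcomp Require Import boolp classical_sets cardinality reals complex.
From mathcomp Require Import mpoly ring zify.

(* A 2x2 matrix M represents the projectivity that defines Gamma(t) exactly when
   it maps each x - t_i y to a multiple of L_i; then Gamma(t) is spanned by
   M (x^d - y^d).  Hence two triples have the same image iff the quotient N of
   their matrices multiplies x^d - y^d by a scalar.  Comparing coefficients, this
   forces N to be diagonal or antidiagonal (d >= 4), i.e. to act on roots of
   unity by z |-> zeta z or z |-> zeta / z = zeta z^*.

   Finiteness of the target uses apolarity.  A secant point a l^d + b m^d has a
   catalecticant (Hankel) matrix of rank at most 2, a closed condition.  After
   moving L to (x, y, x + y), a point of the closure divisible by L_1 L_2 L_3 has
   normalized coefficients a_j that satisfy a linear recurrence of order 2 and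
   a_0 = a_d = 0, with F(1, -1) = 0.  These conditions force
   a_j = c (r^j - s^j) with r <> s, r^d = s^d and (r - 1)^d = (s - 1)^d, so the
   point is determined by the roots of unity r / s and (r - 1) / (s - 1). *)

Set Implicit Arguments.
Unset Strict Implicit.
Unset Printing Implicit Defensive.

Import GRing.Theory Num.Theory.
Local Open Scope ring_scope.

(** * Coefficients of binary forms *)

(** The exponent used in [form_coef], so both name the same coefficient. Subtraction truncates: for
    [n > d] the degree is [n], whence the bounds [n <= d] below. *)
Definition bimon (d n : nat) : 'X_{1..2} :=
  (U_(ord0) *+ n + U_(ord_max) *+ (d - n))%MM.

Lemma ord2P (i : 'I_2) : i = ord0 \/ i = ord_max.
Proof. by case: i => [[|[|k]]] // ?; [left|right]; apply: val_inj. Qed.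

Lemma bimonE d n i : bimon d n i = if i == ord0 then n else (d - n)%N.
Proof.
rewrite /bimon mnmDE !mulmnE !mnm1E.
by case: (ord2P i) => ->; rewrite /= ?mul1n ?mul0n ?addn0 ?add0n.
Qed.

Lemma bimon_inj d m n : (bimon d m == bimon d n) = (m == n).
Proof.
apply/eqP/eqP => [/mnmP/(_ ord0)|->//]; by rewrite !bimonE.
Qed.

Lemma mdeg2 (m : 'X_{1..2}) : mdeg m = (m ord0 + m ord_max)%N.
Proof.
rewrite mdegE big_ord_recl big_ord1; congr (_ + m _)%N; exact: val_inj.
Qed.

Lemma bimonP d (m : 'X_{1..2}) : mdeg m = d -> m = bimon d (m ord0).
Proof.
rewrite mdeg2 => md; apply/mnmP => i; rewrite bimonE -md addKn.
by case: (ord2P i) => ->.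
Qed.

Lemma mdeg_bimon d n : (n <= d)%N -> mdeg (bimon d n) = d.
Proof. by move=> le_nd; rewrite mdeg2 !bimonE /= subnKC. Qed.

Section Forms.
Variable C : numClosedFieldType.

Local Notation x := ('X_ord0 : {mpoly C[2]}).
Local Notation y := ('X_ord_max : {mpoly C[2]}).

Lemma bimonX d n : 'X_[bimon d n] = x ^+ n * y ^+ (d - n) :> {mpoly C[2]}.
Proof. by rewrite /bimon mpolyXD !mpolyXn. Qed.

Lemma form_ext d (F G : Sform C d) :
  (forall n, (n <= d)%N -> (F : {mpoly C[2]})@_(bimon d n) =
    (G : {mpoly C[2]})@_(bimon d n)) ->
  F = G.
Proof.
move=> FG; apply/val_inj/mpolyP => m /=.
have [md|md] := eqVneq (mdeg m) d; last first.
  by rewrite !(dhomog_nemf_coeff (dhomog_is_dhomog _) md).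
rewrite (bimonP md) FG // -md mdeg2; exact: leq_addr.
Qed.

Definition lin_form (u v : C) : {mpoly C[2]} := u *: x + v *: y.

Lemma lin_form_homog u v : lin_form u v \is 1.-homog.
Proof. by rewrite rpredD ?rpredZ ?dhomogX /= ?mdeg1. Qed.

Lemma coef_pow_lin d n u v : (n <= d)%N ->
  (lin_form u v ^+ d)@_(bimon d n) = u ^+ n * v ^+ (d - n) *+ 'C(d, n).
Proof.
move=> le_nd; rewrite /lin_form addrC exprDn raddf_sum /=.
rewrite (bigD1 (Ordinal (le_nd : (n < d.+1)%N))) //= big1 ?addr0 => [|i i_n].
  rewrite mcoeffMn !exprZn -scalerAr -scalerAl mulrC -bimonX !mcoeffZ mcoeffX.
  by rewrite eqxx mulr1 mulrC.
rewrite mcoeffMn !exprZn -scalerAr -scalerAl mulrC -bimonX !mcoeffZ mcoeffX.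
by rewrite bimon_inj -[n]/(val (Ordinal (le_nd : (n < d.+1)%N))) val_eqE
  (negPf i_n) !mulr0 mul0rn.
Qed.

Lemma form_expand d (F : Sform C d) :
  F = \sum_(i < d.+1) form_coef F i *: 'X_[bimon d i] :> {mpoly C[2]}.
Proof.
apply/mpolyP => m; rewrite raddf_sum /=.
have [md|md] := eqVneq (mdeg m) d; last first.
  rewrite (dhomog_nemf_coeff (dhomog_is_dhomog F) md) big1 // => i _.
  rewrite mcoeffZ mcoeffX; have [mE|_] := eqVneq; last by rewrite mulr0.
  by rewrite -mE mdeg_bimon ?eqxx // -ltnS in md.
have le_md : (m ord0 < d.+1)%N by rewrite ltnS -md mdeg2 leq_addr.
rewrite (bimonP md) (bigD1 (Ordinal le_md)) //= big1 ?addr0 => [|i i_n].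
  by rewrite mcoeffZ mcoeffX eqxx mulr1.
rewrite mcoeffZ mcoeffX bimon_inj -[m ord0]/(val (Ordinal le_md)) val_eqE.
by rewrite (negPf i_n) mulr0.
Qed.

Lemma form_meval d (F : Sform C d) v :
  (F : {mpoly C[2]}).@[v] =
  \sum_(i < d.+1) (F : {mpoly C[2]})@_(bimon d i) * (v ord0 ^+ i * v ord_max ^+
    (d - i)).
Proof.
rewrite {1}[F : {mpoly C[2]}]form_expand raddf_sum /=; apply: eq_bigr => i _.
by rewrite mevalZ bimonX mevalM !rmorphXn /= !mevalXU.
Qed.

Lemma lin_subst_coord (A : 'M[C]_2) j :
  tnth (lin_subst A) j = lin_form (A ord0 j) (A ord_max j).
Proof.
rewrite tnth_mktuple big_ord_recl big_ord1 /lin_form;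
  congr (_ + A _ _ *: 'X_ _).
  exact: val_inj.
exact: val_inj.
Qed.

(** Substitution is multiplicative; this makes the Veronese map equivariant. *)
Lemma gl_act_pow d (A : 'M[C]_2) (l : Sform C 1) :
  gl_act A (pow_form d l) = pow_form d (gl_act A l).
Proof. by apply: val_inj; rewrite /= rmorphXn. Qed.

Lemma gl_act_X (A : 'M[C]_2) j :
  ('X_j : {mpoly C[2]}) \mPo lin_subst A = lin_form (A ord0 j) (A ord_max j).
Proof. by rewrite comp_mpolyXU -tnth_nth lin_subst_coord. Qed.

Lemma Sform1E (l : Sform C 1) :
  l = lin_form (lin_coord l ord0 0) (lin_coord l ord_max 0) :> {mpoly C[2]}.
Proof.
rewrite [LHS]lin_coordP big_ord_recl big_ord1 /lin_form.
by congr (_ + lin_coord _ _ _ *: 'X_ _); apply: val_inj.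
Qed.

End Forms.

(** * Finiteness of the target *)

Section Recurrence.
Variable C : numClosedFieldType.

Lemma quadratic_roots (b c : C) : exists r s, r + s = b /\ r * s = c.
Proof.
have two_neq0 : (2 : C) != 0 by rewrite pnatr_eq0.
pose e := sqrtC (b ^+ 2 - 4 * c).
have e2 : e ^+ 2 = b ^+ 2 - 4 * c by apply: sqrtCK.
exists ((b + e) / 2), ((b - e) / 2); split; first by field.
transitivity ((b ^+ 2 - e ^+ 2) / 4); first by field.
by rewrite e2; field.
Qed.

Lemma recurrence2 (a b : nat -> C) d p q :
  a 0 = b 0 -> a 1 = b 1 ->
  (forall j, (j.+2 <= d)%N -> a j.+2 = p * a j.+1 + q * a j) ->
  (forall j, (j.+2 <= d)%N -> b j.+2 = p * b j.+1 + q * b j) ->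
  forall j, (j <= d)%N -> a j = b j.
Proof.
move=> ab0 ab1 aE bE j; elim/ltn_ind: j => -[|[|j]] IH le_jd //.
by rewrite aE // bE // !IH //; lia.
Qed.

(** The characteristic polynomial [q0 + q1 T + q2 T^2] may have a double root or drop in degree. In
    those cases [a 0 = a d = 0] leaves at most one nonzero interior term, which the alternating sum
    excludes. Two distinct roots [r], [s] remain. *)
Lemma apolar_sequence (a : nat -> C) d (q0 q1 q2 : C) : (2 < d)%N ->
  [|| q0 != 0, q1 != 0 | q2 != 0] ->
  (forall j, (j.+2 <= d)%N -> q0 * a j + q1 * a j.+1 + q2 * a j.+2 = 0) ->
  a 0 = 0 -> a d = 0 ->
  \sum_(i < d.+1) a i * (-1) ^+ (d - i) *+ 'C(d, i) = 0 ->
  (exists2 n, (n <= d)%N & a n != 0) ->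
  exists c r s, [/\ r != s, r ^+ d = s ^+ d, (r - 1) ^+ d = (s - 1) ^+ d
    & forall j, (j <= d)%N -> a j = c * (r ^+ j - s ^+ j)].
Proof.
move=> d_gt2 q_neq0 aE a0 ad sum0 [n le_nd an].
(* A lone interior term [a k] would make the alternating sum a nonzero multiple of it. *)
have sum1 (k : nat) : (k <= d)%N -> (0 < k < d)%N ->
    (forall j, (j <= d)%N -> j != k -> a j = 0) -> False.
  move=> le_kd /andP[k_gt0 k_lt] a_k; case/eqP: an.
  have [->|/a_k->//] := eqVneq n k.
  move: sum0; rewrite (bigD1 (Ordinal (le_kd : (k < d.+1)%N))) //= big1 ?addr0.
    move=> /eqP; rewrite mulrn_eq0 mulf_eq0 expf_eq0 oppr_eq0 oner_eq0 andbF
      orbF.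
    by rewrite -leqn0 leqNgt bin_gt0 le_kd /= => /eqP.
  move=> i i_k; rewrite a_k ?mul0r ?mul0rn //; last by rewrite -ltnS.
have [q2_0|q2_neq0] := eqVneq q2 0; last first.
  have [r [s [rs_sum rs_prod]]] := quadratic_roots (- (q1 / q2)) (q0 / q2).
  have {}aE j : (j.+2 <= d)%N -> a j.+2 = (r + s) * a j.+1 + (- (r * s)) * a j.
    move=> /aE aj; apply: (mulfI q2_neq0); rewrite rs_sum rs_prod.
    transitivity (- (q0 * a j + q1 * a j.+1)); last by field.
    by apply/eqP; rewrite -subr_eq0 opprK addrC aj.
  have [r_s|r_neq_s] := eqVneq r s.
    (* Double root: the solution is [j r^(j-1)] up to scale, and the factor [j] hides the truncated
       predecessor at 0. Then [a d = 0] forces [r = 0], so only [a 1] survives. *)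
    have aj j : (j <= d)%N -> a j = a 1%N * (r ^+ j.-1 *+ j).
      apply: (@recurrence2 a (fun j =>
        a 1%N * (r ^+ j.-1 *+ j)) d _ _ _ _ aE) => /=.
      - by rewrite a0 mulr0n mulr0.
      - by rewrite expr0 mulr1n mulr1.
      case=> [|i] _ /=; rewrite -r_s; first by rewrite expr0 expr1 mulr0n; ring.
      by rewrite !exprS !mulrS; ring.
    have a1_neq0 : a 1%N != 0.
      by apply: contraNneq an => a1; rewrite aj // a1 mul0r.
    move: ad; rewrite aj // => /eqP; rewrite mulf_eq0 (negPf a1_neq0) /=.
    rewrite mulrn_eq0 expf_eq0 => /orP[/eqP d0|/andP[_ /eqP r0]].
      by rewrite d0 in d_gt2.
    case: (@sum1 1%N); [lia|lia|] => -[|[|j]] // le_jd _.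
    by rewrite aj // r0 /= exprS mul0r mul0rn mulr0.
  have rs0 : r - s != 0 by rewrite subr_eq0.
  pose c := a 1%N / (r - s).
  have aj j : (j <= d)%N -> a j = c * (r ^+ j - s ^+ j).
    apply: (@recurrence2 a (fun j => c * (r ^+ j - s ^+ j)) d _ _ _ _ aE).
    - by rewrite a0 !expr0 subrr mulr0.
    - by rewrite !expr1 /c mulfVK.
    by move=> i _; rewrite !exprS; ring.
  have c_neq0 : c != 0 by apply: contraNneq an => c0; rewrite aj // c0 mul0r.
  exists c, r, s; split=> //.
    by apply/eqP; rewrite -subr_eq0 -(mulrI_eq0 _ (mulfI c_neq0)) -aj ?ad.
  (* By the binomial theorem the alternating sum is [c ((r - 1)^d - (s - 1)^d)]. *)
  apply/eqP; rewrite -subr_eq0 -(mulrI_eq0 _ (mulfI c_neq0)) -sum0.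
  apply/eqP; rewrite [r - 1]addrC [s - 1]addrC !exprDn -sumrB mulr_sumr.
  apply: eq_bigr => i _; rewrite aj -1?ltnS // -mulrnBl mulrnAr; congr (_ *+ _).
  by ring.
have [q1_0|q1_neq0] := eqVneq q1 0.
  have q0_neq0 : q0 != 0 by move: q_neq0; rewrite q1_0 q2_0 eqxx !orbF.
  (* The relation reduces to [a j = 0] for [j <= d - 2], leaving only [a (d - 1)]. *)
  case: (@sum1 d.-1); [lia|lia|] => j le_jd j_d.
  have [->//|j_neqd] := eqVneq j d.
  have /aE : (j.+2 <= d)%N by lia.
  by rewrite q1_0 q2_0 !mul0r !addr0 => /eqP;
    rewrite mulf_eq0 (negPf q0_neq0) => /eqP.
(* Each term below [d] is now a multiple of its predecessor, so all vanish; the index 1 is an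
   arbitrary choice. *)
case: (@sum1 1%N); [lia|lia|] => j le_jd _; have [->//|j_neqd] := eqVneq j d.
have {le_jd j_neqd} : (j < d)%N by lia.
elim: j => [//|j IH] lt_jd; have := aE j lt_jd.
rewrite q2_0 mul0r addr0 IH; last lia.
by rewrite mulr0 add0r => /eqP; rewrite mulf_eq0 (negPf q1_neq0) => /eqP.
Qed.

(** With [z = r / s] and [w = (r - 1) / (s - 1)], the equation [z s - 1 = w (s - 1)] is linear in
    [s]; [r != s] gives [z != w], so it can be solved. *)
Lemma unity_parameters d (r s : C) : (0 < d)%N ->
  r != s -> r ^+ d = s ^+ d -> (r - 1) ^+ d = (s - 1) ^+ d ->
  exists z w, [/\ z ^+ d = 1, w ^+ d = 1, s = (1 - w) / (z - w) & r = z * s].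
Proof.
move=> d_gt0 r_neq_s rs rs1.
have ratio (u v : C) : u != v -> u ^+ d = v ^+ d ->
    v != 0 /\ (u / v) ^+ d = 1.
  move=> u_v uv; have v_neq0 : v != 0.
    apply: contraNneq u_v => v0; move: uv; rewrite v0 expr0n eqn0Ngt d_gt0.
    by move/eqP; rewrite expf_eq0 => /andP[].
  by split=> //; rewrite expr_div_n uv divff ?expf_neq0.
have [s_neq0 zd] := ratio _ _ r_neq_s rs.
have [|s1_neq0 wd] := ratio (r - 1) (s - 1) _ rs1;
  first by rewrite (inj_eq (addIr _)).
have sr_neq0 : s - r != 0 by rewrite subr_eq0 eq_sym.
exists (r / s), ((r - 1) / (s - 1)); split=> //; last by rewrite divfK.
have -> : 1 - (r - 1) / (s - 1) = (s - r) / (s - 1) by field.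
have -> : r / s - (r - 1) / (s - 1) = (s - r) / (s * (s - 1)).
  by field; rewrite s_neq0 s1_neq0.
by field; rewrite s_neq0 s1_neq0 sr_neq0.
Qed.

End Recurrence.

(** * Catalecticant minors and the closure of the secants *)

Section Hankel.
Variables (C : numClosedFieldType) (d : nat) (A : 'M[C]_2).

(** Dividing by the binomial coefficient makes the coefficients of a [d]-th power geometric. The
    substitution [A] is built in so that the rank condition holds in every coordinate system without
    proving the closure invariant under [A]. *)
Definition apolar_coef (p : {mpoly C[2]}) (n : nat) : C :=
  (p \mPo lin_subst A)@_(bimon d n) / 'C(d, n)%:R.

(** The catalecticant matrix of [p] after the substitution [A]; its kernel consists of the quadratic
    forms apolar to it. Indices [j + k] never exceed [d]. *)
Definition hankel (p : {mpoly C[2]}) : 'M[C]_(d.-1, 3) :=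
  \matrix_(j, k) apolar_coef p (j + k).

Definition hankel_minor (f : 'I_3 -> 'I_d.-1) (p : {mpoly C[2]}) : C :=
  \det (rowsub f (hankel p)).

(** The minor as a polynomial in the homogeneous coordinates of P S_d: each entry is linear in the
    coefficients of the form. *)
Definition hankel_poly (f : 'I_3 -> 'I_d.-1) : {mpoly C[d.+1]} :=
  \det (\matrix_(i < 3, k < 3)
    (\sum_(l < d.+1) apolar_coef 'X_[bimon d l] (f i + k) *: 'X_l)).

(** Rows are chosen by arbitrary maps [f]; a repeated row only adds the trivial equation. *)
Definition hankel_variety : set (proj (Sform C d)) :=
  [set p : proj (Sform C d) | forall f, hankel_minor f
    (rep p : {mpoly C[2]}) = 0]%classic.

Lemma apolar_coefZD c p q n :
  apolar_coef (c *: p + q) n = c * apolar_coef p n + apolar_coef q n.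
Proof.
by rewrite /apolar_coef comp_mpolyD comp_mpolyZ mcoeffD mcoeffZ mulrDl mulrA.
Qed.

Lemma apolar_coef_sum (I : finType) (c : I -> C) (F : I -> {mpoly C[2]}) n :
  apolar_coef (\sum_i c i *: F i) n = \sum_i c i * apolar_coef (F i) n.
Proof.
rewrite /apolar_coef [(\sum_i _) \mPo _]raddf_sum raddf_sum mulr_suml /=;
  apply: eq_bigr => i _.
by rewrite comp_mpolyZ mcoeffZ mulrA.
Qed.

Lemma hankel_polyE f (F : Sform C d) :
  (hankel_poly f).@[form_coef F] = hankel_minor f F.
Proof.
rewrite /hankel_poly -det_map_mx; congr (\det _); apply/matrixP => i k.
rewrite !mxE raddf_sum /= [in RHS]form_expand apolar_coef_sum.
by apply: eq_bigr => l _; rewrite mevalZ mevalXU mulrC.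
Qed.

Lemma hankel_poly_homog f : hankel_poly f \is homog mdeg.
Proof.
apply/homogP; exists 3; rewrite /hankel_poly rpred_sum // => s _.
(* Each Leibniz term is a sign times three linear forms, hence the degree 3. *)
rewrite -signr_odd; have h : \prod_i (\matrix_(i < 3, k < 3)
    (\sum_(l < d.+1) apolar_coef 'X_[bimon d l] (f i + k) *: 'X_l)) i (s i)
    \is 3.-homog.
  rewrite !big_ord_recl big_ord0 mulr1.
  have h i k : (\matrix_(i < 3, k < 3)
    (\sum_(l < d.+1) apolar_coef 'X_[bimon d l] (f i + k) *: 'X_l)) i k
    \is 1.-homog.
    by rewrite mxE rpred_sum // => l _; rewrite rpredZ // dhomogX /= mdeg1.
  by apply: (@dhomogM _ _ _ 1 _ 2) => //; apply: (@dhomogM _ _ _ 1 _ 1).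
case: (odd _); last by rewrite expr0 mul1r.
by rewrite expr1 mulN1r rpredN.
Qed.

Lemma hankel_variety_closed : zariski_closed hankel_variety.
Proof.
exists (range hankel_poly); split=> [_ [f _ <-]|];
  first exact: hankel_poly_homog.
apply/seteqP; split=> p /= h.
  by move=> _ [f _ <-]; rewrite /vanishes hankel_polyE.
by move=> f; rewrite -hankel_polyE; apply: h; exists f.
Qed.

(** If [A] sends [l] to [u x + v y], the entry is [u^(j+k) v^(d-j-k)], which splits into a factor in
    [j] and a factor in [k]. *)
Lemma hankel_pow (l : Sform C 1) : exists (c : 'cV[C]_d.-1) (r : 'rV[C]_3),
  hankel ((l : {mpoly C[2]}) ^+ d) = c *m r.
Proof.
pose u := lin_coord (gl_act A l) ord0 0;
  pose v := lin_coord (gl_act A l) ord_max 0.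
exists (\col_j (u ^+ j * v ^+ (d - 2 - j))), (\row_k (u ^+ k * v ^+ (2 - k))).
apply/matrixP => j k; rewrite !mxE big_ord1 !mxE /apolar_coef.
have [j_lt k_lt] : (j < d.-1)%N /\ (k < 3)%N by split; apply: ltn_ord.
have le_jkd : (j + k <= d)%N by lia.
have -> : ((l : {mpoly C[2]}) ^+ d \mPo lin_subst A) = lin_form u v ^+ d.
  by rewrite rmorphXn /= -[_ \mPo _]/(val (gl_act A l)) [val _]Sform1E.
rewrite coef_pow_lin // -mulr_natr mulfK; last first.
  by rewrite pnatr_eq0 -lt0n bin_gt0.
have -> : (d - (j + k) = (d - 2 - j) + (2 - k))%N by lia.
by rewrite !exprD mulrACA.
Qed.

Lemma secants_hankel : (secants d `<=` hankel_variety)%classic.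
Proof.
move=> p [_ [_ [[q _ <-] [r _ <-] _ p_qr]]] f.
have : rep p \in (veronese d q + veronese d r)%VS.
  by apply: (subvP p_qr); apply: memv_pick.
case/memv_addP => _ /vlineP[a ->] [_ /vlineP[b ->] ->].
have [c1 [r1 h1]] := hankel_pow (rep q).
have [c2 [r2 h2]] := hankel_pow (rep r).
(* The sum of two matrices of rank at most 1 factors through dimension 2, so no 3 by 3 minor is
   invertible. *)
have hE : hankel
      (a *: (rep q : {mpoly C[2]}) ^+ d + b *: (rep r : {mpoly C[2]}) ^+ d) =
    row_mx (a *: c1) (b *: c2) *m col_mx r1 r2.
  rewrite mul_row_col -!scalemxAl -h1 -h2; apply/matrixP => j k.
  rewrite !mxE apolar_coefZD -[b *: _]addr0 apolar_coefZD.
  by rewrite /apolar_coef comp_mpoly0 mcoeff0 mul0r addr0.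
apply/eqP; rewrite -[_ == 0]negbK -unitfE -unitmxE.
apply/negP => /mxrank_unit.
rewrite /hankel_minor /= hE -mul_rowsub_mx => rk.
by have := mulmx_max_rank
  (rowsub f (row_mx (a *: c1) (b *: c2))) (col_mx r1 r2); rewrite rk.
Qed.

(** All minors vanish on the closure, since [hankel_variety] is closed and contains the secants.
    Three columns of rank below 3 have a nonzero kernel vector. *)
Lemma closure_secants_apolar (p : proj (Sform C d)) :
  zariski_closure (secants d) p ->
  exists2 q : 'cV[C]_3, q != 0 & hankel (rep p : {mpoly C[2]}) *m q = 0.
Proof.
pose H := hankel (rep p : {mpoly C[2]}) => p_cl.
have p_min := p_cl _ (conj hankel_variety_closed secants_hankel).
have : kermx H^T != 0.
  rewrite kermx_eq0 /row_free mxrank_tr; apply/negP => H_full.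
  (* Full column rank would provide three rows with an invertible minor. *)
  have := fullrowsub_unit (H_full : row_full H).
  by rewrite unitmxE -/(hankel_minor _ _) p_min unitr0.
case/rowV0Pn => v /sub_kermxP vH v_neq0; exists v^T.
  by rewrite -(inj_eq trmx_inj) trmxK trmx0.
by apply: trmx_inj; rewrite trmx_mul trmxK vH trmx0.
Qed.

End Hankel.

(** * Finiteness of the multiples in the closure *)

Section Finiteness.
Variables (C : numClosedFieldType) (d : nat).
Variable d_ge4 : (4 <= d)%N.

Definition lin_Sform (u v : C) : Sform C 1 := DHomog (lin_form_homog u v).

(** Its normalized coefficients are [r^n - s^n], the shape found in [apolar_sequence]. *)
Definition two_powers (r s : C) : Sform C d :=
  pow_form d (lin_Sform r 1) - pow_form d (lin_Sform s 1).

Lemma meval_lin_form (u v : C) w :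
  (lin_form u v).@[w] = u * w ord0 + v * w ord_max.
Proof. by rewrite mevalD !mevalZ !mevalXU. Qed.

Lemma multiples_meval (L : 3.-tuple (proj (Sform C 1))) (A : 'M[C]_2)
    (p : proj (Sform C d)) i w :
  multiples d L p ->
  (gl_act A (rep (tnth L i)) : {mpoly C[2]}).@[w] = 0 ->
  (gl_act A (rep p) : {mpoly C[2]}).@[w] = 0.
Proof.
case=> G pE; rewrite /= pE => Li0.
by rewrite rmorphM rmorph_prod /= mevalM rmorph_prod /= (bigD1 i) //= Li0 mul0r
  mulr0.
Qed.

(** Every such point lies in a family indexed by pairs of roots of unity, by [apolar_sequence] and
    [unity_parameters]. *)
Lemma finite_multiples_closure (L : 3.-tuple (proj (Sform C 1))) : uniq L ->
  finite_set (multiples d L `&` zariski_closure (secants d))%classic.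
Proof.
move=> L_uniq; have [B B_unit B_L] := frame_ex L_uniq.
pose A := invmx B.
(* [A] carries the three points of [L] to the classes of [x], [y] and [x + y], whose coordinates are
   the vectors [std_frame]. *)
have AL_zero i (w : 'I_2 -> C) :
    std_frame C i ord0 0 * w ord0 + std_frame C i ord_max 0 * w ord_max = 0 ->
    (gl_act A (rep (tnth L i)) : {mpoly C[2]}).@[w] = 0.
  move=> w0; have [c c_neq0 BLi] := B_L i.
  rewrite Sform1E meval_lin_form lin_coord_act.
  have -> : lin_coord (rep (tnth L i)) = c^-1 *: (B *m std_frame C i).
    by rewrite BLi scalerA mulVf // scale1r.
  have scE k : (c^-1 *: std_frame C i) k 0 = c^-1 * std_frame C i k 0.
    by rewrite mxE.
  by rewrite -scalemxAr mulKmx // !scE -!mulrA -mulrDr w0 mulr0.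
(* For [z = w] the quotient is 0 and the value is the zero subspace; this is harmless, as only a
   finite superset is wanted. *)
pose g (zw : Theta C d * Theta C d) : {vspace Sform C d} :=
  let z := val zw.1 in let w := val zw.2 in let s := (1 - w) / (z - w) in
  <[gl_act B (two_powers (z * s) s)]>%VS.
apply: (@sub_finite_set _ _ (@line_of _ _ @^-1` range g)%classic); last first.
  apply: finite_preimage; first by move=> p q _ _; apply: proj_inj.
  apply: finite_image; exact: finite_finset.
move=> p [p_L /(closure_secants_apolar A)[q q_neq0 Hq]].
pose F := gl_act A (rep p).
pose a n := apolar_coef d A (rep p) n.
have F_a n : (n <= d)%N -> (F : {mpoly C[2]})@_(bimon d n) = a n *+ 'C(d, n).
  move=> le_nd; rewrite /a /apolar_coef -[RHS]mulr_natr divfK //.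
  by rewrite pnatr_eq0 -lt0n bin_gt0.
have F_zero i w := @multiples_meval L A p i w p_L \o @AL_zero i w.
have [] := @apolar_sequence _ a d (q ord0 0) (q (inord 1) 0) (q ord_max 0)
  (ltnW d_ge4).
- apply: contraNT q_neq0;
  rewrite !negb_or !negbK => /and3P[/eqP q0 /eqP q1 /eqP q2].
  apply/eqP/colP => k; rewrite [RHS]mxE.
  have [->|k0] := eqVneq k ord0; first exact: q0.
  have [->|k2] := eqVneq k ord_max; first exact: q2.
  rewrite -q1; congr (q _ 0); apply: val_inj; rewrite /= inordK //.
  by case: k k0 k2 => [[|[|[|k]]]].
(* Row [j] of the kernel equation is the recurrence at [j]. *)
- move=> j le_jd; have lt_jd : (j < d.-1)%N by lia.
  have /colP/(_ (Ordinal lt_jd)) := Hq; rewrite !mxE !big_ord_recr big_ord0 /=.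
  rewrite add0r !mxE /= addn0 => <-.
  rewrite -/(a _) -/(a _) -/(a _) ![q _ _ * _]mulrC addn1 addn2.
  by congr (_ * q _ _ + _ * q _ _ + _ * q _ _); apply: val_inj;
    rewrite /= ?inordK.
(* The factor [x] vanishes at (0, 1), where only the coefficient of [y^d] is seen. *)
- have : (F : {mpoly C[2]}).@[fun k => (k == ord_max)%:R] = 0.
    by apply: (F_zero ord0); rewrite !mxE /= mulr0 mul0r addr0.
  rewrite form_meval big_ord_recl big1 => [|k _] /=.
    by rewrite addr0 expr0 expr1n !mulr1 F_a // bin0.
  by rewrite exprS !mul0r mulr0.
(* Likewise for the factor [y], at (1, 0). *)
- have : (F : {mpoly C[2]}).@[fun k => (k == ord0)%:R] = 0.
    by apply: (F_zero (inord 1));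
      rewrite !mxE -!val_eqE /= inordK //= mulr0 mul0r addr0.
  rewrite form_meval big_ord_recr big1 => [|k _] /=.
    by rewrite add0r expr1n subnn expr0 !mulr1 F_a // binn.
  by rewrite expr0n subn_eq0 leqNgt ltn_ord /= !mulr0.
(* The factor [x + y] vanishes at (1, -1), which yields the alternating sum. *)
- have F1 : (F : {mpoly C[2]}).@[fun k => if k == ord0 then 1 else -1] = 0.
    by apply: (F_zero ord_max); rewrite !mxE /= !mul1r subrr.
  rewrite -[RHS]F1 form_meval; apply: eq_bigr => i _ /=.
  by rewrite F_a -1?ltnS // expr1n mul1r mulrnAl.
- apply: contrapT => a_0; case/eqP: (rep_neq0 p).
  have F0 : F = 0.
    apply: form_ext => n le_nd; rewrite F_a //= mcoeff0.
    have [->|an] := eqVneq (a n) 0; first by rewrite mul0rn.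
    by case: a_0; exists n.
  by rewrite -(gl_act1 (rep p)) -(mulmxV B_unit) gl_actM -/A -/F F0 raddf0.
move=> c [r [s [r_s rs rs1 aE]]].
have d_gt0 : (0 < d)%N by lia.
have [z [w [zd wd sE rE]]] := unity_parameters d_gt0 r_s rs rs1.
have in_theta u : u ^+ d = 1 -> exists t : Theta C d, val t = u.
  move/unity_rootP => u_root.
  have u_in : u \in roots_seq C d by rewrite mem_roots_seq.
  by exists (SeqSub u_in).
have [z' z'E] := in_theta z zd; have [w' w'E] := in_theta w wd.
exists (z', w') => //; rewrite /g /= z'E w'E -sE -rE.
have FE : F = c *: two_powers r s.
  apply: form_ext => n le_nd; rewrite F_a // aE //= mcoeffZ mcoeffB.
  by rewrite !coef_pow_lin // !expr1n !mulr1 -mulrnBl mulrnAr.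
have pE : rep p = c *: gl_act B (two_powers r s).
  by rewrite -linearZ -FE /= -gl_actM mulmxV // gl_act1.
rewrite line_of_rep pE; apply/eqP; rewrite eqEsubv -!memvE memvZ ?memv_line //.
have := rep_neq0 p; rewrite pE scaler_eq0 negb_or => /andP[c_neq0 _].
rewrite andbT; apply/vlineP; exists c^-1; by rewrite scalerA mulVf // scale1r.
Qed.
End Finiteness.

(** * The map Gamma and its fibres *)

(** Remove one root at a time: in a domain the other roots stay roots of the quotient. The
    coefficient ring will be C[x, y], which is not a field. *)
Lemma idomain_roots_factor (R : idomainType) (p : {poly R}) (rs : seq R) :
  uniq rs -> all (root p) rs -> exists q, p = q * \prod_(r <- rs) ('X - r%:P).
Proof.
elim: rs p => [|r rs IH] p /=; first by exists p; rewrite big_nil mulr1.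
case/andP=> r_rs rs_uniq /andP[/factor_theorem[q ->] /allP pr].
have [|q' ->] := IH q rs_uniq.
  apply/allP => s s_rs; have := pr s s_rs; rewrite rootM root_XsubC.
  by case/orP => // /eqP s_r; rewrite -s_r s_rs in r_rs.
by exists q'; rewrite big_cons -mulrA [X in _ * X]mulrC.
Qed.

(** * Matrices that represent the projectivity of a triple *)

Section Points.
Variable C : numClosedFieldType.

Lemma line_of_mem (V : vectType C) (p : proj V) (v : V) :
  v != 0 -> v \in line_of p -> line_of p = <[v]>%VS.
Proof.
move=> v_neq0 v_p; apply/esym/eqP.
by rewrite eqEdim -memvE v_p dim_vline v_neq0 /line_of (eqP (svalP p)).
Qed.

Lemma vline_scale (V : vectType C) (c : C) (v : V) :
  c != 0 -> <[c *: v]>%VS = <[v]>%VS.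
Proof.
move=> c_neq0; apply: subv_anti; rewrite -!memvE memvZ ?memv_line //=.
by rewrite -{1}[v]scale1r -(mulVf c_neq0) -scalerA memvZ ?memv_line.
Qed.

Lemma gl_act_inj d (A : 'M[C]_2) : A \in unitmx -> injective (@gl_act C d A).
Proof.
by move=> A_unit; apply: (can_inj (g := gl_act (invmx A))) => F;
  rewrite -gl_actM mulVmx // gl_act1.
Qed.

Lemma gl_act_neq0 d (A : 'M[C]_2) (F : Sform C d) :
  A \in unitmx -> F != 0 -> gl_act A F != 0.
Proof.
by move=> A_unit; apply: contra_neq => AF; apply: (gl_act_inj A_unit);
  rewrite raddf0.
Qed.

Lemma root_formE (xi : C) : root_form xi = lin_form 1 (- xi) :> {mpoly C[2]}.
Proof. by rewrite /lin_form scale1r scaleNr. Qed.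

Lemma coef_lin_form (u v : C) :
  (lin_form u v)@_U_(ord0) = u /\ (lin_form u v)@_U_(ord_max) = v.
Proof.
by split; rewrite mcoeffD !mcoeffZ !mcoeffX !eq_mnm1 /= ?mulr1 ?mulr0 ?addr0
  ?add0r.
Qed.

Lemma lin_form_inj (u v u' v' : C) :
  lin_form u v = lin_form u' v' -> u = u' /\ v = v'.
Proof.
move=> uv; have [{2}<- {2}<-] := coef_lin_form u' v'; rewrite -uv.
by have [-> ->] := coef_lin_form u v.
Qed.

Lemma lin_formZ (c u v : C) : c *: lin_form u v = lin_form (c * u) (c * v).
Proof. by rewrite /lin_form scalerDr !scalerA. Qed.

(** The coefficient of [x] forces [c = 1]. *)
Lemma root_form_prop (c xi eta : C) :
  root_form xi = c *: root_form eta -> xi = eta.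
Proof.
move=> xi_eta; have : lin_form 1 (- xi) = c *: lin_form 1 (- eta).
  by rewrite -!root_formE xi_eta.
rewrite lin_formZ => /lin_form_inj[]; rewrite mulr1 => <-; rewrite mul1r.
exact: oppr_inj.
Qed.

Lemma projectivityP (p q : 3.-tuple (proj (Sform C 1))) : uniq p -> uniq q ->
  forall i, pgl_act (projectivity p q) (tnth p i) = tnth q i.
Proof.
move=> p_uniq q_uniq;
  have [phi [phi_pq _]] := projectivity_unique p_uniq q_uniq.
pose P := [set phi | forall i, pgl_act phi (tnth p i) = tnth q i]%classic.
by have : P (projectivity p q) by apply: xgetPex; exists phi.
Qed.

Section Cover.
Variables (d : nat) (d_ge4 : (4 <= d)%N).

Lemma root_pt_inj : injective (@root_pt C).
Proof.
move=> xi eta /(congr1 (@line_of _ _)) /= eq_line.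
have : root_form xi \in <[root_form eta]>%VS by rewrite -eq_line memv_line.
by case/vlineP => c /root_form_prop.
Qed.

Lemma pgl_act_pt e phi (A : 'M[C]_2) (p : proj (Sform C e)) F :
  A != 0 -> A \in line_of (sval phi) -> F != 0 -> F \in line_of p ->
  gl_act A F \in line_of (pgl_act phi p).
Proof. by move=> *; rewrite (@pgl_actE _ _ _ _ A F) // memv_line. Qed.

(** Frees [Gamma] from the chosen representative: by uniqueness of the projectivity, any matrix with
    the right effect on the three points computes it. *)
Lemma Gamma_line (L : 3.-tuple (proj (Sform C 1)))
    (t : 3.-tuple (Theta C d)) (M : 'M[C]_2) :
  uniq t -> uniq L -> M \in unitmx ->
  (forall i, exists c, gl_act M (root_form (val (tnth t i))) =
    c *: rep (tnth L i)) ->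
  line_of (Gamma d_ge4 L t) = <[gl_act M (fermat_form C d)]>%VS.
Proof.
move=> t_uniq L_uniq M_unit M_L.
pose p := [tuple of map (@root_pt C \o val) t].
have p_uniq : uniq p by rewrite map_inj_uniq // => xi eta /root_pt_inj /val_inj.
have M_p i : pgl_act (pgl_of M_unit) (tnth p i) = tnth L i.
  have [c M_c] := M_L i; apply: proj_inj; rewrite tnth_map.
  have M_mem : gl_act M (root_form (val (tnth t i))) \in
      line_of (pgl_act (pgl_of M_unit) (root_pt (val (tnth t i)))).
    apply: pgl_act_pt; rewrite ?unitmx2_neq0 ?memv_line ?root_form_neq0 //.
  have M_neq0 := gl_act_neq0 M_unit (root_form_neq0 (val (tnth t i))).
  rewrite (line_of_mem M_neq0 M_mem); apply/esym/line_of_mem => //.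
  by rewrite M_c memvZ ?memv_pick.
have -> : Gamma d_ge4 L t = pgl_act (pgl_of M_unit) (fermat_pt C d_ge4).
  congr (pgl_act _ _); have [phi [_ phi_uniq]] :=
    projectivity_unique p_uniq L_uniq.
  by rewrite -(phi_uniq _ M_p) -(phi_uniq _ (projectivityP p_uniq L_uniq)).
by apply: pgl_actE; rewrite ?unitmx2_neq0 ?memv_line ?fermat_form_neq0.
Qed.

(** The converse supply: the representative of the projectivity is such a matrix, and its scalars
    are nonzero because it is invertible. *)
Lemma Gamma_frame (L : 3.-tuple (proj (Sform C 1)))
    (t : 3.-tuple (Theta C d)) : uniq t -> uniq L ->
  exists M : 'M[C]_2, [/\ M \in unitmx,
    forall i, exists2 c, c != 0 &
      gl_act M (root_form (val (tnth t i))) = c *: rep (tnth L i) &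
    line_of (Gamma d_ge4 L t) = <[gl_act M (fermat_form C d)]>%VS].
Proof.
move=> t_uniq L_uniq.
pose p := [tuple of map (@root_pt C \o (val : Theta C d -> C)) t].
have p_uniq : uniq p by rewrite map_inj_uniq // => xi eta /root_pt_inj /val_inj.
pose phi := projectivity p L; pose M := rep (sval phi).
have M_unit : M \in unitmx := svalP phi.
suff M_L i : exists2 c, c != 0 &
    gl_act M (root_form (val (tnth t i))) = c *: rep (tnth L i).
  exists M; split=> //; apply: Gamma_line => // i.
  by have [c _ Mc] := M_L i; exists c.
have phi_i := projectivityP p_uniq L_uniq i.
have : gl_act M (root_form (val (tnth t i))) \in line_of (tnth L i).
  rewrite -phi_i; apply: pgl_act_pt;
    rewrite ?rep_neq0 ?root_form_neq0 ?memv_pick //.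
  by rewrite tnth_map memv_line.
rewrite line_of_rep => /vlineP[c Mc]; exists c => //.
apply: contraTneq (gl_act_neq0 M_unit (root_form_neq0 (val (tnth t i)))) => c0.
by rewrite Mc c0 scale0r eqxx.
Qed.

End Cover.
End Points.

(** * Values of [Gamma] and its fibres as dihedral orbits *)

Section Fibres.
Variables (C : numClosedFieldType) (d : nat) (d_ge4 : (4 <= d)%N).

Let d_gt0 : (0 < d)%N. Proof. exact: leq_trans d_ge4. Qed.

Lemma ThetaX (z : Theta C d) : val z ^+ d = 1.
Proof. by apply/unity_rootP; rewrite -mem_roots_seq //; apply: valP. Qed.

Lemma Theta_ex (u : C) : u ^+ d = 1 -> exists z : Theta C d, val z = u.
Proof.
move/unity_rootP; rewrite -mem_roots_seq // => u_root.
by exists (SeqSub u_root).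
Qed.

(** In characteristic 0 the polynomial [X^d - 1] is separable, so its [d] roots are distinct. *)
Lemma card_Theta : #|Theta C d| = d.
Proof.
rewrite card_seq_sub.
  rewrite /roots_seq; case: closed_field_poly_normal => r /= rE.
  have /(congr1 (fun p : {poly C} => size p)) := rE.
  rewrite size_XnsubC // size_scale ?size_prod_XsubC; first by case.
  by rewrite lead_coef_eq0 -size_poly_eq0 size_XnsubC.
rewrite /roots_seq; case: closed_field_poly_normal => r /= rE.
rewrite -separable_prod_XsubC.
have lead_neq0 : lead_coef ('X^d - 1 : {poly C}) != 0.
  by rewrite lead_coef_eq0 -size_poly_eq0 size_XnsubC.
rewrite -(eqp_separable (eqp_scale _ lead_neq0)) -rE.
by apply: separable_Xn_sub_1; rewrite pnatr_eq0 -lt0n.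
Qed.

Lemma fermat_factor (t : 3.-tuple (Theta C d)) : uniq t ->
  exists G : {mpoly C[2]},
    (fermat_form C d : {mpoly C[2]}) =
      G * \prod_(i < 3) (root_form (val (tnth t i)) : {mpoly C[2]}).
Proof.
move=> t_uniq.
(* x^d - y^d as a polynomial in x over C[x, y], with roots z y. *)
pose r := [seq val z *: ('X_ord_max : {mpoly C[2]}) | z : Theta C d <- t].
have r_uniq : uniq r.
  rewrite map_inj_uniq // => z w /(congr1 (mcoeff U_(ord_max))) /=.
  by rewrite !mcoeffZ !mcoeffX eqxx !mulr1 => /val_inj.
pose P : {poly {mpoly C[2]}} := 'X^d - ('X_ord_max ^+ d)%:P.
have [|q qE] := @idomain_roots_factor _ P r r_uniq.
  apply/allP => _ /mapP[z _ ->]; apply/rootP.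
  by rewrite /P hornerD hornerN hornerC hornerXn exprZn ThetaX scale1r subrr.
exists q.['X_ord0] => /=; have /(congr1 (horner^~ 'X_ord0)) := qE.
rewrite /P hornerD hornerN hornerC hornerXn hornerM horner_prod big_map => ->.
rewrite big_tuple; congr (_ * _); apply: eq_bigr => i _.
by rewrite hornerXsubC.
Qed.

Lemma Gamma_multiples (L : 3.-tuple (proj (Sform C 1)))
    (t : 3.-tuple (Theta C d)) :
  uniq t -> uniq L -> multiples d L (Gamma d_ge4 L t).
Proof.
move=> t_uniq L_uniq;
  have [M [M_unit M_L GE]] := Gamma_frame d_ge4 t_uniq L_uniq.
have /vlineP[k rE] : rep (Gamma d_ge4 L t) \in <[gl_act M (fermat_form C d)]>%VS.
  by rewrite -GE memv_pick.
have [G /= FE] := fermat_factor t_uniq.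
have [|c cE] := @boolp.choice _ _ (fun i c =>
    gl_act M (root_form (val (tnth t i))) = c *: rep (tnth L i)).
  by move=> i; have [c _ Mc] := M_L i; exists c.
exists ((k * \prod_i c i) *: (G \mPo lin_subst M)); rewrite rE /= FE.
rewrite rmorphM rmorph_prod /= -scalerAl -scalerA; congr (_ *: _).
rewrite scalerAr -scaler_prod; congr (_ * _).
by apply: eq_bigr => i _; apply: (congr1 val (cE i)).
Qed.

Lemma fermat_formE :
  fermat_form C d = pow_form d (lin_Sform 1 0) - pow_form d (lin_Sform 0 1).
Proof. by apply: val_inj;
  rewrite /= /lin_form !scale1r !scale0r addr0 add0r. Qed.

Lemma pow_formZ (c : C) (l : Sform C 1) : pow_form d (c *: l) =
  c ^+ d *: pow_form d l.
Proof. by apply: val_inj; rewrite /= exprZn. Qed.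

(** Rescaling [l] by [c] rescales its power by [c^d], so any spanning vector may replace [rep p]. *)
Lemma veronese_line (p : proj (Sform C 1)) (l : Sform C 1) :
  l != 0 -> l \in line_of p -> line_of (veronese d p) = <[pow_form d l]>%VS.
Proof.
move=> l_neq0; rewrite line_of_rep => /vlineP[c lE].
have c_neq0 : c != 0 by apply: contraNneq l_neq0 => c0; rewrite lE c0 scale0r.
by rewrite lE pow_formZ vline_scale ?expf_neq0.
Qed.

Lemma lin_Sform_neq0 (u v : C) : (u != 0) || (v != 0) -> lin_Sform u v != 0.
Proof.
apply: contraTneq => /(congr1 val) /= uv0.
have [] := @lin_form_inj _ u v 0 0;
  first by rewrite uv0 /lin_form !scale0r addr0.
by move=> -> ->; rewrite eqxx.
Qed.

(** The point [x^d - y^d] lies on the secant through [x^d] and [y^d]; the matrix [M] carries that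
    secant to another one. *)
Lemma Gamma_secants (L : 3.-tuple (proj (Sform C 1)))
    (t : 3.-tuple (Theta C d)) :
  uniq t -> uniq L -> secants d (Gamma d_ge4 L t).
Proof.
move=> t_uniq L_uniq; have [M [M_unit _ GE]] := Gamma_frame d_ge4 t_uniq L_uniq.
have X_neq0 : lin_Sform (1 : C) 0 != 0 by rewrite lin_Sform_neq0 ?oner_neq0.
have Y_neq0 : lin_Sform (0 : C) 1 != 0 by rewrite lin_Sform_neq0 ?oner_neq0 ?orbT.
have MX_neq0 := gl_act_neq0 M_unit X_neq0.
have MY_neq0 := gl_act_neq0 M_unit Y_neq0.
pose p := proj_pt MX_neq0; pose q := proj_pt MY_neq0.
have pE := veronese_line MX_neq0 (memv_line _ : _ \in line_of p).
have qE := veronese_line MY_neq0 (memv_line _ : _ \in line_of q).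
exists (veronese d p), (veronese d q); split; [by exists p|by exists q| |].
  move=> pq; have : pow_form d (gl_act M (lin_Sform 1 0)) \in
      line_of (veronese d q).
    by rewrite -pq pE memv_line.
  rewrite qE -!gl_act_pow => /vlineP[k];
    rewrite -linearZ => /(gl_act_inj M_unit).
  (* The coefficient of [x^d] shows that [x^d] is no multiple of [y^d]. *)
  move/(congr1 (fun F : Sform C d => (F : {mpoly C[2]})@_(bimon d d))) => /=.
  rewrite mcoeffZ !coef_pow_lin // !expr0n subnn (gtn_eqF d_gt0) /= expr1n
    expr0.
  by rewrite mul0r mul0rn mulr0 mulr1 binn => /eqP; rewrite oner_eq0.
rewrite GE pE qE -memvE fermat_formE raddfB /= !gl_act_pow.
by rewrite memvB // memvE ?addvSl ?addvSr.
Qed.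

(** Roots of unity have modulus 1. This turns reflections of [Theta] into projectivities. *)
Lemma conj_unity (u : C) : u ^+ d = 1 -> u^* = u^-1.
Proof.
move=> ud; have u_norm : `|u| = 1.
  by apply/eqP; rewrite -(@pexpr_eq1 _ _ d) // -normrX ud normr1.
have u_neq0 : u != 0 by rewrite -normr_eq0 u_norm oner_neq0.
by apply: (mulfI u_neq0); rewrite -normCK u_norm expr1n mulfV.
Qed.

Lemma gl_act_lin (A : 'M[C]_2) u v :
  gl_act A (lin_Sform u v) =
  lin_Sform (u * A ord0 ord0 + v * A ord0 ord_max)
            (u * A ord_max ord0 + v * A ord_max ord_max).
Proof.
apply: val_inj => /=;
  rewrite /lin_form comp_mpolyD !comp_mpolyZ !gl_act_X /lin_form.
by rewrite !scalerDr !scalerDl !scalerA addrACA.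
Qed.

Lemma root_form_lin (xi : C) : root_form xi = lin_Sform 1 (- xi).
Proof. by apply: val_inj; rewrite /= -root_formE. Qed.

Lemma lin_SformZ (c u v : C) : c *: lin_Sform u v = lin_Sform (c * u) (c * v).
Proof. by apply: val_inj; rewrite /= lin_formZ. Qed.

(** Columns are images of variables: [x] goes to [a x + c y] and [y] to [b x + e y]. *)
Definition mx2 (a b c e : C) : 'M[C]_2 :=
  \matrix_(i, j) if i == ord0 then if j == ord0 then a else b
                 else if j == ord0 then c else e.

Lemma det_mx2 (a b c e : C) : \det (mx2 a b c e) = a * e - b * c.
Proof.
rewrite (expand_det_row _ ord0) !big_ord_recl big_ord0 /cofactor !det_mx11 !mxE
  /=.
by rewrite addr0 !addn0 expr0 mul1r expr1 mulN1r mulrN.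
Qed.

Lemma diag_root (a e xi : C) :
  a != 0 -> gl_act (mx2 a 0 0 e) (root_form xi) = a *: root_form (e / a * xi).
Proof.
move=> a_neq0; rewrite !root_form_lin gl_act_lin lin_SformZ !mxE /=.
by congr lin_Sform; field.
Qed.

Lemma antidiag_root (b c xi : C) : b != 0 -> xi != 0 ->
  gl_act (mx2 0 b c 0) (root_form xi) =
  (- (xi * b)) *: root_form (c / b * xi^-1).
Proof.
move=> b_neq0 xi_neq0; rewrite !root_form_lin gl_act_lin lin_SformZ !mxE /=.
by congr lin_Sform; field; rewrite ?b_neq0 ?xi_neq0.
Qed.

(** The coefficients of [x y^(d-1)] and [x^2 y^(d-2)] in the image vanish. Together with
    invertibility they leave only one diagonal of [N], and the coefficients of [x^d] and [y^d] make
    the ratio of its entries a root of unity. *)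
Lemma stabilizer_fermat (N : 'M[C]_2) k : N \in unitmx ->
  gl_act N (fermat_form C d) = k *: fermat_form C d ->
  exists2 z, z ^+ d = 1 &
    (exists2 a, a != 0 & N = mx2 a 0 0 (z * a)) \/
    (exists2 b, b != 0 & N = mx2 0 b (z * b) 0).
Proof.
move=> N_unit; rewrite fermat_formE raddfB /= !gl_act_pow !gl_act_lin.
rewrite !mul1r !mul0r !addr0 !add0r => NF.
pose a := N ord0 ord0; pose b := N ord0 ord_max.
pose c := N ord_max ord0; pose e := N ord_max ord_max.
have NE : N = mx2 a b c e.
  apply/matrixP => i j; rewrite !mxE.
  by case: (ord2P i) => ->; case: (ord2P j) => ->.
have det_neq0 : a * e - b * c != 0.
  by have := N_unit; rewrite NE unitmxE unitfE det_mx2.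
have coefs n : (n <= d)%N -> a ^+ n * c ^+ (d - n) - b ^+ n * e ^+ (d - n) =
    k * ((n == d)%:R - (n == 0)%:R).
  move=> le_nd; move/(congr1 (fun F : Sform C d =>
    (F : {mpoly C[2]})@_(bimon d n))) : NF.
  rewrite /= mcoeffZ !mcoeffB !coef_pow_lin // -!mulrnBl mulrnAr.
  move/eqP; rewrite -subr_eq0 -mulrnBl mulrn_eq0 eqn0Ngt bin_gt0 le_nd /=
    subr_eq0.
  move/eqP; rewrite !expr1n !expr0n mul1r mulr1 subn_eq0 => ->.
  by rewrite [(d <= n)%N](_ : _ = (n == d)) // eqn_leq le_nd.
have coef_d : a ^+ d - b ^+ d = k.
  have := coefs d (leqnn d).
  by rewrite subnn !expr0 !mulr1 eqxx (gtn_eqF d_gt0) /= subr0 mulr1.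
have coef_0 : c ^+ d - e ^+ d = - k.
  have := coefs 0%N (leq0n d).
  by rewrite subn0 !expr0 !mul1r eq_sym (gtn_eqF d_gt0) /= sub0r mulrN1.
have mid n : (0 < n < d)%N -> a ^+ n * c ^+ (d - n) = b ^+ n * e ^+ (d - n).
  case/andP=> n_gt0 n_lt; apply/eqP; rewrite -subr_eq0 coefs 1?ltnW //.
  by rewrite (gtn_eqF n_gt0) ltn_eqF // subr0 mulr0.
have [m dE] : exists m, d = m.+3 by exists d.-2.-1; lia.
have mid1 : a * c ^+ m.+2 = b * e ^+ m.+2.
  by have := mid 1%N; rewrite dE subn1 !expr1 => ->.
have mid2 : a ^+ 2 * c ^+ m.+1 = b ^+ 2 * e ^+ m.+1.
  by have := mid 2%N; rewrite dE subn2 => ->.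
(* The two relations multiply crosswise to a multiple of the determinant. *)
have : a * b * c ^+ m.+1 * e ^+ m.+1 * (a * e - b * c) = 0.
  transitivity ((a ^+ 2 * c ^+ m.+1) * (b * e ^+ m.+2) -
                (b ^+ 2 * e ^+ m.+1) * (a * c ^+ m.+2)).
    by rewrite (exprSr c m.+1) (exprSr e m.+1); ring.
  by rewrite mid2 mid1 subrr.
have diag : a != 0 -> e != 0 -> b = 0 -> c = 0 -> exists2 z, z ^+ d = 1 &
    (exists2 a, a != 0 & N = mx2 a 0 0 (z * a)) \/
    (exists2 b, b != 0 & N = mx2 0 b (z * b) 0).
  move=> a_neq0 e_neq0 b0 c0; exists (e / a).
    rewrite expr_div_n; have -> : e ^+ d = a ^+ d;
      last by rewrite mulfV ?expf_neq0.
    move: coef_0 coef_d; rewrite b0 c0 expr0n (gtn_eqF d_gt0) subr0 sub0r.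
    by move=> /oppr_inj -> ->.
  by left; exists a => //; rewrite divfK // {1}NE b0 c0.
have anti : b != 0 -> c != 0 -> a = 0 -> e = 0 -> exists2 z, z ^+ d = 1 &
    (exists2 a, a != 0 & N = mx2 a 0 0 (z * a)) \/
    (exists2 b, b != 0 & N = mx2 0 b (z * b) 0).
  move=> b_neq0 c_neq0 a0 e0; exists (c / b).
    rewrite expr_div_n; have -> : c ^+ d = b ^+ d;
      last by rewrite mulfV ?expf_neq0.
    move: coef_0 coef_d; rewrite a0 e0 expr0n (gtn_eqF d_gt0) subr0 sub0r =>
      -> <-.
    by rewrite opprK.
  by right; exists b => //; rewrite divfK // {1}NE a0 e0.
move/eqP; rewrite !mulf_eq0 (negPf det_neq0) orbF !expf_eq0 /= => abce.
have zero_ad : (a == 0) || (e == 0) -> [/\ b != 0 & c != 0].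
  move=> ae; apply/andP; rewrite -negb_or -mulf_eq0;
    apply: contra det_neq0 => /eqP ->.
  by rewrite subr0 mulf_eq0.
have zero_bc : (b == 0) || (c == 0) -> [/\ a != 0 & e != 0].
  move=> bc; apply/andP; rewrite -negb_or -mulf_eq0;
    apply: contra det_neq0 => /eqP ->.
  by rewrite sub0r oppr_eq0 mulf_eq0.
have eq0_of (u v : C) n : u != 0 -> 0 = u * v ^+ n.+1 -> v = 0.
  by move=> u_neq0 /esym/eqP; rewrite mulf_eq0 (negPf u_neq0) expf_eq0 => /eqP.
have eq0_of' (u v : C) n : v != 0 -> 0 = u * v ^+ n.+1 -> u = 0.
  by move=> v_neq0 /esym/eqP;
    rewrite mulf_eq0 expf_eq0 (negPf v_neq0) andbF orbF => /eqP.
(* Some entry is zero. The determinant makes the two entries off its diagonal nonzero, and then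
   [mid1] kills the other entry of its diagonal. *)
move: mid1; case/orP: abce => [/orP[/orP[]|]|] /eqP u0.
- have [|b_neq0 c_neq0] := zero_ad; first by rewrite u0 eqxx.
  by rewrite u0 mul0r => /(eq0_of _ _ _ b_neq0); apply: anti.
- have [|a_neq0 e_neq0] := zero_bc; first by rewrite u0 eqxx.
  by rewrite u0 mul0r => /esym /(eq0_of _ _ _ a_neq0); apply: diag.
- have [|a_neq0 e_neq0] := zero_bc; first by rewrite u0 eqxx orbT.
  by rewrite u0 exprS mul0r mulr0 => /(eq0_of' _ _ _ e_neq0) b0; apply: diag.
- have [|b_neq0 c_neq0] := zero_ad; first by rewrite u0 eqxx orbT.
  by rewrite u0 [0 ^+ _]exprS mul0r mulr0 => /esym/(eq0_of' _ _ _ c_neq0) a0;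
    apply: anti.
Qed.

Lemma unity_neq0 (u : C) : u ^+ d = 1 -> u != 0.
Proof.
by move=> ud; apply: contra_eq_neq ud => ->;
  rewrite expr0n (gtn_eqF d_gt0) eq_sym oner_neq0.
Qed.

Lemma perm_of_Theta (f : C -> C) : injective f ->
  (forall u, u ^+ d = 1 -> f u ^+ d = 1) ->
  exists s : {perm Theta C d}, forall z, val (s z) = f (val z).
Proof.
move=> f_inj fX; have [|g gE] :=
  @boolp.choice _ _ (fun z w : Theta C d => val w = f (val z)).
  by move=> z; apply: Theta_ex => //; apply: fX; apply: ThetaX.
have g_inj : injective g by move=> z w /(congr1 val);
  rewrite !gE => /f_inj/val_inj.
by exists (perm g_inj) => z; rewrite permE.
Qed.

(** Equal images make the quotient of the two matrices stabilize the class of [x^d - y^d].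
    Conversely a dihedral symmetry is realized by a diagonal or antidiagonal matrix with that
    property. *)
Lemma Gamma_fibre (L : 3.-tuple (proj (Sform C 1)))
    (t t' : 3.-tuple (Theta C d)) :
  uniq L -> uniq t -> uniq t' ->
  Gamma d_ge4 L t = Gamma d_ge4 L t' <->
  exists2 s, s \in dihedral C d_ge4 & ('P * 3)%act t s = t'.
Proof.
move=> L_uniq t_uniq t'_uniq.
have [M' [M'_unit M'_L GE']] := Gamma_frame d_ge4 t'_uniq L_uniq.
split=> [Gtt'|[s]].
  have [M [M_unit M_L GE]] := Gamma_frame d_ge4 t_uniq L_uniq.
  pose N := invmx M' *m M.
  have N_unit : N \in unitmx by rewrite unitmx_mul unitmx_inv M'_unit.
  have N_root i : exists c, gl_act N (root_form (val (tnth t i))) =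
      c *: root_form (val (tnth t' i)).
    have [c _ Mc] := M_L i; have [c' c'_neq0 Mc'] := M'_L i; exists (c / c').
    rewrite gl_actM Mc -scalerA -[root_form (val (tnth t' i))](gl_act1).
    rewrite -(mulVmx M'_unit) gl_actM Mc' !linearZ /= scalerA mulVf // scale1r.
    by [].
  have : gl_act M (fermat_form C d) \in <[gl_act M' (fermat_form C d)]>%VS.
    by rewrite -GE' -Gtt' GE memv_line.
  case/vlineP => k /(congr1 (gl_act (invmx M'))).
  rewrite linearZ /= -!gl_actM mulVmx // gl_act1 =>
    /(stabilizer_fermat N_unit).
  (* [N] sends the form of [t i] to multiples of two root forms, which must then coincide. *)
  have eq_t' f : (forall i, exists2 c, c != 0 &
      gl_act N (root_form (val (tnth t i))) =
        c *: root_form (f (val (tnth t i)))) ->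
      forall i, val (tnth t' i) = f (val (tnth t i)).
    move=> Nf i; have [c c_neq0 Nc] := Nf i; have [b Nb] := N_root i.
    apply/esym; apply: (@root_form_prop _ (c^-1 * b)).
    by rewrite -scalerA -Nb Nc scalerA mulVf // scale1r.
  case=> z zd NE; have [z' z'E] := Theta_ex zd;
    have z_neq0 := unity_neq0 zd.
  case: NE => -[a a_neq0 NE].
    have [||s sE] := @perm_of_Theta ( *%R z); first exact: mulfI.
      by move=> u ud; rewrite exprMn zd ud mulr1.
    exists s; first by rewrite inE; apply/existsP; exists z'; apply/orP; left;
      apply/forallP => w; rewrite sE z'E.
    apply: eq_from_tnth => i; apply: val_inj; rewrite tnth_map [LHS]sE.
    apply/esym/(eq_t' ( *%R z)) => j; exists a => //.
    by rewrite NE diag_root // mulfK.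
  have [||s sE] := @perm_of_Theta (fun u => z * u^*).
  - by move=> u v /(mulfI z_neq0) /(can_inj (@conjCK C)).
  - by move=> u ud; rewrite exprMn zd -rmorphXn ud rmorph1 mulr1.
  exists s; first by rewrite inE; apply/existsP; exists z'; apply/orP; right;
    apply/forallP => w; rewrite sE z'E.
  apply: eq_from_tnth => i; apply: val_inj; rewrite tnth_map [LHS]sE.
  apply/esym/(eq_t' (fun u => z * u^*)) => j.
  have u_neq0 := unity_neq0 (ThetaX (tnth t j)).
  exists (- (val (tnth t j) * a)); first by rewrite oppr_eq0 mulf_neq0.
  by rewrite NE antidiag_root // mulfK // (conj_unity) ?ThetaX.
rewrite inE => /existsP[z sz] t'E.
have z_neq0 := unity_neq0 (ThetaX z).
have t'i i : tnth t' i = s (tnth t i) by rewrite -t'E tnth_map.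
(* Then [M' *m N] serves as a matrix for [t], and it spans the same point as [M']. *)
suff [N N_unit [N_root [k k_neq0 N_F]]] : exists2 N : 'M[C]_2, N \in unitmx &
    (forall i, exists c, gl_act N (root_form (val (tnth t i))) =
      c *: root_form (val (tnth t' i))) /\
    exists2 k, k != 0 & gl_act N (fermat_form C d) = k *: fermat_form C d.
  apply: proj_inj; rewrite GE' (@Gamma_line _ _ _ _ _ (M' *m N)) //.
  - by rewrite gl_actM N_F linearZ /= vline_scale.
  - by rewrite unitmx_mul M'_unit.
  move=> i; have [c Nc] := N_root i; have [c' _ M'c] := M'_L i.
  by exists (c * c'); rewrite gl_actM Nc linearZ /= M'c scalerA.
case/orP: sz => /forallP sz.
  exists (mx2 1 0 0 (val z)).
    by rewrite unitmxE unitfE det_mx2 mul1r mul0r subr0.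
  split=> [i|]; first by exists 1;
    rewrite diag_root ?oner_neq0 // divr1 t'i (eqP (sz _)).
  exists 1; rewrite ?oner_neq0 // scale1r fermat_formE raddfB /= !gl_act_pow
    !gl_act_lin.
  rewrite !mxE /= !mul1r !mul0r !addr0 !add0r.
  have -> : lin_Sform 0 (val z) =
      val z *: lin_Sform 0 1 by rewrite lin_SformZ mulr0 mulr1.
  by rewrite pow_formZ ThetaX // scale1r.
exists (mx2 0 1 (val z) 0).
  by rewrite unitmxE unitfE det_mx2 mul0r mul1r sub0r oppr_eq0.
split=> [i|].
  exists (- (val (tnth t i) * 1));
    rewrite antidiag_root ?oner_neq0 ?unity_neq0 ?ThetaX //.
  by rewrite divr1 t'i (eqP (sz _)) (conj_unity) ?ThetaX.
(* The antidiagonal matrix exchanges [x^d] and [y^d], up to [z^d = 1], which reverses the sign. *)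
exists (- 1); rewrite ?oppr_eq0 ?oner_neq0 // scaleN1r.
rewrite fermat_formE raddfB opprB /= !gl_act_pow !gl_act_lin.
rewrite !mxE /= !mul1r !mul0r !addr0 !add0r.
have -> : lin_Sform 0 (val z) =
    val z *: lin_Sform 0 1 by rewrite lin_SformZ mulr0 mulr1.
by rewrite pow_formZ ThetaX // scale1r.
Qed.

(** Since [Theta] has more than two elements, each [z] starts some distinct triple; fixing that
    triple fixes [z]. *)
Lemma dihedral_faithful :
  [faithful dihedral C d_ge4, on distinct_triples C d | 'P * 3].
Proof.
apply/faithfulP => s _ s_id; apply/permP => z; rewrite perm1.
have [u [v [uz vz uv]]] : exists u v, [/\ u != z, v != z & u != v].
  have : (1 < #|[set~ z]|)%N.
    by rewrite cardsC1 card_Theta // -subn1 ltn_subRL; apply: leq_trans d_ge4.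
  by case/card_gt1P => u [v []]; rewrite !inE => ? ? ?; exists u, v.
have : [tuple z; u; v] \in distinct_triples C d.
  rewrite /distinct_triples inE /= !inE negb_or ![z == _]eq_sym uz vz uv /=.
  by apply/fintype.subsetP => w _; rewrite inE.
by move/s_id/(congr1 (fun t : 3.-tuple _ => tnth t ord0)).
Qed.

Lemma Gamma_cover (L : 3.-tuple (proj (Sform C 1))) : uniq L ->
  is_cover (dihedral C d_ge4) ('P * 3)%act (distinct_triples C d)
    (multiples d L `&` zariski_closure (secants d))%classic (Gamma d_ge4 L).
Proof.
move=> L_uniq; have in_X t : (t \in distinct_triples C d) = uniq t.
  by rewrite /distinct_triples inE andb_idr // => _;
    apply/fintype.subsetP => w _; rewrite inE.
have acts_X : [acts dihedral C d_ge4, on distinct_triples C d | 'P * 3].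
  by apply/actsP => s _ t; rewrite !in_X map_inj_uniq //; apply: act_inj.
split=> //.
- exact: finite_multiples_closure.
- move=> t; rewrite in_X => t_uniq; split; first exact: Gamma_multiples.
  by move=> Z [_]; apply; apply: Gamma_secants.
- exact: dihedral_faithful.
(* The two partitions agree block by block: the fibre through [t] is its orbit. *)
apply: eq_in_imset => t t_X; apply/setP => t'; rewrite inE.
apply/andP/orbitP => [[t'_X /eqP]|[s sD st]].
  by apply: (Gamma_fibre _ _ _).1 => //; rewrite -in_X.
have t'_X : t' \in distinct_triples C d.
  by rewrite -st (actsP acts_X).
split=> //; apply/eqP.
by apply: (Gamma_fibre _ _ _).2; rewrite -?in_X //; exists s.
Qed.

End Fibres.

Local Open Scope classical_set_scope.

Theorem theorem4p10 (R : realType) (d : nat) (d_ge4 : (4 <= d)%N) :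
  let X := distinct_triples R[i] d in
  (forall L : 3.-tuple (proj (Sform R[i] 1)), uniq L ->
     is_cover (dihedral R[i] d_ge4) ('P * 3)%act X
       (multiples d L `&` zariski_closure (secants d : set (proj (Sform R[i] d))))
       (Gamma d_ge4 L)) /\
  (forall L L' : 3.-tuple (proj (Sform R[i] 1)), uniq L -> uniq L' ->
     #|preim_partition (Gamma d_ge4 L) X| =
     #|preim_partition (Gamma d_ge4 L') X|).
Proof.
(* Both fibre partitions equal the orbit partition, which does not involve the triple of points. *)
split=> [L L_uniq|L L' /(Gamma_cover d_ge4)[_ _ _ _ ->]]; first exact: Gamma_cover.
by case/(Gamma_cover d_ge4) => _ _ _ _ ->.
Qed.
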